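(* If a hypersurface $f\colon M^n\to \mathbb{H}^k\times \mathbb{S}^{n-k+1}$, $n\geq 5$, $2\leq k\leq n-1$, has no principal curvature of multiplicity greater than $n-3$ (at any point), then it is weakly rigid.
   Context: $\mathbb{H}^k$ and $\mathbb{S}^m$ have constant sectional curvature $-1$ and $1$; the Riemannian product $\mathbb{H}^k\times\mathbb{S}^{n-k+1}$ is regarded as a submanifold of $\mathbb{L}^{k+1}\oplus\mathbb{R}^{n-k+2}=\mathbb{L}^{n+3}$ (Lorentz space), with $\mathbb{H}^k$ one sheet of $\{\langle x,x\rangle=-1\}\subset\mathbb{L}^{k+1}$ and $\mathbb{S}^{n-k+1}$ the unit sphere. A hypersurface is an isometric immersion $f\colon M^n\to\mathbb{H}^k\times\mathbb{S}^{n-k+1}$ of an $n$-dimensional connected Riemannian manifold; its principal curvatures are the eigenvalues of its shape operator. $f$ and $g$ are weakly congruent if, as maps into $\mathbb{L}^{n+3}$, $g=\Phi\circ f$ for some linear isometry $\Phi$ of $\mathbb{L}^{n+3}$ (congruence included). $f$ is weakly rigid if any other isometric immersion $g\colon M^n\to\mathbb{H}^k\times\mathbb{S}^{n-k+1}$ is weakly congruent to $f$. *)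

(* Defs.v *)
From mathcomp Require Import all_boot all_order all_algebra.
From mathcomp Require Import all_classical all_reals all_analysis.
Set Implicit Arguments.
Unset Strict Implicit.
Unset Printing Implicit Defensive.
Import Order.TTheory GRing.Theory Num.Theory.
Import numFieldNormedType.Exports.
Local Open Scope classical_set_scope.
Local Open Scope ring_scope.

(* Vectors are rows and linear maps act on the right: row i
   of a Jacobian is the i-th partial derivative. *)

Definition basis_vec (R : realType) (n : nat) (i : 'I_n) : 'rV[R]_n :=
  delta_mx 0 i.

Definition partial (R : realType) (n : nat) (V : normedModType R) (i : 'I_n)
    (F : 'rV[R]_n -> V) : 'rV[R]_n -> V :=
  fun x => 'D_(basis_vec R i) F x.

(* C^infinity on an open set U: the iterated partial derivatives of all orders
   (s = [::] gives F itself) are Frechet differentiable on U. *)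
Definition smooth_on (R : realType) (n : nat) (V : normedModType R)
    (U : set 'rV[R]_n) (F : 'rV[R]_n -> V) : Prop :=
  forall (s : seq 'I_n) (x : 'rV[R]_n), U x ->
    differentiable (foldr (@partial R n V) F s) x.

(* A smooth n-manifold given by a smooth atlas indexed by [chart].  The values
   of [coord a] outside [dom a], and of [param a] outside [coord a @` dom a],
   are irrelevant. *)
Record smoothManifold (R : realType) (n : nat) := SmoothManifold {
  carrier :> topologicalType ;
  carrier_hausdorff : hausdorff_space carrier ;
  carrier_second_countable : @second_countable carrier ;
  chart : Type ;
  dom : chart -> set carrier ;
  coord : chart -> carrier -> 'rV[R]_n ;
  param : chart -> 'rV[R]_n -> carrier ;
  dom_cover : forall p, exists a, dom a p ;
  dom_open : forall a, open (dom a) ;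
  coord_dom_open : forall a, open (coord a @` dom a) ;
  coordK : forall a p, dom a p -> param a (coord a p) = p ;
  coord_continuous :
    forall a p, dom a p -> {for p, continuous (coord a)} ;
  param_continuous :
    forall a p, dom a p -> {for coord a p, continuous (param a)} ;
  transition_smooth : forall a b,
    smooth_on (coord a @` (dom a `&` dom b)) (coord b \o param a)
}.

(* [gram a p] is the Gram matrix of the metric of T_p M in the coordinate basis
   of the chart a, meaningful for p in [dom a]. *)
Record riemannianMetric (R : realType) (n : nat) (M : smoothManifold R n) :=
  RiemannianMetric {
  gram : chart M -> M -> 'M[R]_n ;
  gram_sym : forall a p, dom a p -> (gram a p)^T = gram a p ;
  gram_pos : forall a p, dom a p ->
    forall v : 'rV[R]_n, v != 0 -> 0 < (v *m gram a p *m v^T) 0 0 ;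
  gram_smooth : forall a,
    smooth_on (coord a @` dom a) (gram a \o param a) ;
  gram_transition : forall (a b : chart M) p, dom a p -> dom b p ->
    let J := jacobian (coord b \o param a) (coord a p) in
    gram a p = J *m gram b p *m J^T
}.

Definition lorentz (R : realType) (k : nat) (u v : 'rV[R]_k.+1) : R :=
  - (u 0 ord0 * v 0 ord0)
  + \sum_(i < k) u 0 (lift ord0 i) * v 0 (lift ord0 i).

Definition euclid (R : realType) (m : nat) (u v : 'rV[R]_m) : R :=
  \sum_(i < m) u 0 i * v 0 i.

(* 'rV_(k.+1 + m.+1) is the Lorentz space L^(k+1) (+) R^(m+1). *)
Definition ldot (R : realType) (k m : nat) (z w : 'rV[R]_(k.+1 + m.+1)) : R :=
  lorentz (lsubmx z) (lsubmx w) + euclid (rsubmx z) (rsubmx w).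

Definition hyperbolic (R : realType) (k : nat) : set 'rV[R]_k.+1 :=
  [set x | lorentz x x = -1 /\ 0 < x 0 ord0].

Definition sphere (R : realType) (m : nat) : set 'rV[R]_m.+1 :=
  [set y | euclid y y = 1].

Definition HxS (R : realType) (k m : nat) : set 'rV[R]_(k.+1 + m.+1) :=
  [set z | hyperbolic (lsubmx z) /\ sphere (rsubmx z)].

(* The tangent space of H^k x S^m at z, and the orthogonal projection of
   L^(k+1) (+) R^(m+1) onto it. *)
Definition tangent_HxS (R : realType) (k m : nat) (z : 'rV[R]_(k.+1 + m.+1)) :
    set 'rV[R]_(k.+1 + m.+1) :=
  [set w | lorentz (lsubmx z) (lsubmx w) = 0 /\
           euclid (rsubmx z) (rsubmx w) = 0].

Definition proj_HxS (R : realType) (k m : nat) (z w : 'rV[R]_(k.+1 + m.+1)) :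
    'rV[R]_(k.+1 + m.+1) :=
  row_mx (lsubmx w + lorentz (lsubmx z) (lsubmx w) *: lsubmx z)
         (rsubmx w - euclid (rsubmx z) (rsubmx w) *: rsubmx z).

(* The differential of an isometric f is injective because the metric of M is
   definite, so f is automatically an immersion. *)
Definition isometric_immersion (R : realType) (n k m : nat)
    (M : smoothManifold R n) (G : riemannianMetric M)
    (f : M -> 'rV[R]_(k.+1 + m.+1)) : Prop :=
  [/\ forall p, HxS (f p),
      forall a : chart M, smooth_on (coord a @` dom a) (f \o param a) &
      forall (a : chart M) p, dom a p -> forall v w : 'rV[R]_n,
        ldot ('d (f \o param a) (coord a p) v)
             ('d (f \o param a) (coord a p) w)
        = (v *m gram G a p *m w^T) 0 0].

(* The i-th coordinate vector field of the chart a, pushed forward by f. *)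
Definition coord_tangent (R : realType) (n k m : nat) (M : smoothManifold R n)
    (f : M -> 'rV[R]_(k.+1 + m.+1)) (a : chart M) (p : M) (i : 'I_n) :
    'rV[R]_(k.+1 + m.+1) :=
  partial i (f \o param a) (coord a p).

(* w minus its orthogonal projection onto the image of the differential of f. *)
Definition normal_component (R : realType) (n k m : nat)
    (M : smoothManifold R n) (G : riemannianMetric M)
    (f : M -> 'rV[R]_(k.+1 + m.+1)) (a : chart M) (p : M)
    (w : 'rV[R]_(k.+1 + m.+1)) : 'rV[R]_(k.+1 + m.+1) :=
  let c := (\row_j ldot w (coord_tangent f a p j)) *m invmx (gram G a p) in
  w - \sum_(i < n) c 0 i *: coord_tangent f a p i.

(* The value on the i-th and j-th coordinate fields of the second fundamental
   form of f in H^k x S^m, whose Levi-Civita connection is the tangential part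
   of the flat derivative of L^(k+1) (+) R^(m+1). *)
Definition second_fundamental_form (R : realType) (n k m : nat)
    (M : smoothManifold R n) (G : riemannianMetric M)
    (f : M -> 'rV[R]_(k.+1 + m.+1)) (a : chart M) (p : M) (i j : 'I_n) :
    'rV[R]_(k.+1 + m.+1) :=
  normal_component G f a p
    (proj_HxS (f p) (partial i (partial j (f \o param a)) (coord a p))).

Definition unit_normal (R : realType) (n k m : nat) (M : smoothManifold R n)
    (f : M -> 'rV[R]_(k.+1 + m.+1)) (a : chart M) (p : M)
    (xi : 'rV[R]_(k.+1 + m.+1)) : Prop :=
  [/\ tangent_HxS (f p) xi,
      forall i, ldot (coord_tangent f a p i) xi = 0 & ldot xi xi = 1].

(* The matrix, in the coordinate basis of the chart a, of the endomorphism A of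
   T_p M defined by <A X, Y> = <alpha(X, Y), xi>. *)
Definition shape_operator (R : realType) (n k m : nat)
    (M : smoothManifold R n) (G : riemannianMetric M)
    (f : M -> 'rV[R]_(k.+1 + m.+1)) (a : chart M) (p : M)
    (xi : 'rV[R]_(k.+1 + m.+1)) : 'M[R]_n :=
  (\matrix_(i, j) ldot (second_fundamental_form G f a p i j) xi)
    *m invmx (gram G a p).

Definition principal_curvature (R : realType) (n k m : nat)
    (M : smoothManifold R n) (G : riemannianMetric M)
    (f : M -> 'rV[R]_(k.+1 + m.+1)) (a : chart M) (p : M)
    (xi : 'rV[R]_(k.+1 + m.+1)) (lambda : R) : Prop :=
  eigenvalue (shape_operator G f a p xi) lambda.

Definition multiplicity (R : realType) (n k m : nat)
    (M : smoothManifold R n) (G : riemannianMetric M)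
    (f : M -> 'rV[R]_(k.+1 + m.+1)) (a : chart M) (p : M)
    (xi : 'rV[R]_(k.+1 + m.+1)) (lambda : R) : nat :=
  \rank (eigenspace (shape_operator G f a p xi) lambda).

(* Phi is bijective because ldot is nondegenerate. *)
Definition weakly_congruent (R : realType) (k m : nat) (T : Type)
    (f g : T -> 'rV[R]_(k.+1 + m.+1)) : Prop :=
  exists2 Phi : {linear 'rV[R]_(k.+1 + m.+1) -> 'rV[R]_(k.+1 + m.+1)},
    forall z w, ldot (Phi z) (Phi w) = ldot z w & g = Phi \o f.

Definition weakly_rigid (R : realType) (n k m : nat) (M : smoothManifold R n)
    (G : riemannianMetric M) (f : M -> 'rV[R]_(k.+1 + m.+1)) : Prop :=
  forall g : M -> 'rV[R]_(k.+1 + m.+1),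
    isometric_immersion G g -> weakly_congruent f g.

(* Main.v *)
From HB Require Import structures.
From mathcomp Require Import all_boot all_order all_algebra.
From mathcomp Require Import all_classical all_reals all_analysis.
From mathcomp Require Import zify ring lra.
Require Import Defs.
Set Implicit Arguments.
Unset Strict Implicit.
Unset Printing Implicit Defensive.
Import Order.TTheory GRing.Theory Num.Theory.
Import numFieldNormedType.Exports.
Local Open Scope ring_scope.

(* The product H^k x S^(n-k+1) lies in the light cone of L^(n+3), so the theorem
   is an instance of Cartan's conformal rigidity.  Let A and B be the second
   fundamental forms of f and g in the direction of a unit normal, G the metric
   and D the difference of the first fundamental forms of their H^k components.
   By the Gauss equations the bilinear form (A, B, D, G) with values in the
   quadratic space (a, b, d, c) |-> a^2 - b^2 - 2 d c is flat in the sense of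
   Moore.  When no eigenvalue of A has multiplicity above n - 3, flatness forces
   this form to be null, which says exactly that <f_ij, f_kl> = <g_ij, g_kl> for
   the flat second derivatives.  Hence at each point a unique linear isometry
   Phi sends the 2-jet of f to that of g.  The derivative of Phi is skew, kills f
   and its first derivatives, and maps f_jk symmetrically in the direction of
   differentiation, which forces it to vanish; so Phi is locally constant, and
   constant because M is connected. *)

(** * Bilinear forms and flatness *)

(** The quadratic space has dimension four, so for n at least 5 every X has a nonzero Y on which the
    form with values in it vanishes. Its signature is (2, 2), so no definiteness argument turns
    flatness into nullity. Instead one looks for a single eigenvector Y common to A, B and D
    relative to G whose eigenvalues form a null vector: flatness tested on Y expresses D through A,
    B and G, and what remains is that A - a G and B - b G have the same 2 x 2 minors. Such minors
    determine a form up to sign once its rank is at least 3, and the multiplicity bound says that A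
    - a G has this rank for every a. The cases where B is plus or minus A up to a multiple of G
    escape the search for Y and are settled directly.

    Unit normals are chosen point by point, with no continuity in the point. Regularity of Phi comes
    from elsewhere: Phi solves a linear system whose coefficients are derivatives of f and g of
    order at most two. *)

Definition bform (R : comNzRingType) (n : nat) (A : 'M[R]_n) (u v : 'rV[R]_n) : R :=
  (u *m A *m v^T) 0 0.

Section Bform.
Variables (R : comNzRingType) (n : nat).
Implicit Types (A B : 'M[R]_n) (u v w : 'rV[R]_n) (c : R).

Lemma bformDl A u v w : bform A (u + v) w = bform A u w + bform A v w.
Proof. by rewrite /bform !mulmxDl mxE. Qed.

Lemma bformDr A u v w : bform A u (v + w) = bform A u v + bform A u w.
Proof. by rewrite /bform linearD mulmxDr mxE. Qed.

Lemma bformZl A c u v : bform A (c *: u) v = c * bform A u v.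
Proof. by rewrite /bform -!scalemxAl mxE. Qed.

Lemma bformZr A c u v : bform A u (c *: v) = c * bform A u v.
Proof. by rewrite /bform linearZ -scalemxAr mxE. Qed.

Lemma bformNl A u v : bform A (- u) v = - bform A u v.
Proof. by rewrite -scaleN1r bformZl mulN1r. Qed.

Lemma bformNr A u v : bform A u (- v) = - bform A u v.
Proof. by rewrite -scaleN1r bformZr mulN1r. Qed.

Lemma bform_addm A B u v : bform (A + B) u v = bform A u v + bform B u v.
Proof. by rewrite /bform mulmxDr mulmxDl mxE. Qed.

Lemma bform_scalem A c u v : bform (c *: A) u v = c * bform A u v.
Proof. by rewrite /bform -scalemxAr -scalemxAl mxE. Qed.

Lemma bform_oppm A u v : bform (- A) u v = - bform A u v.
Proof. by rewrite /bform mulmxN mulNmx mxE. Qed.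

Lemma bformC A u v : A^T = A -> bform A u v = bform A v u.
Proof.
move=> symA; rewrite /bform -[in RHS](trmxK (v *m A *m u^T)) [in RHS]mxE.
by rewrite !trmx_mul trmxK symA mulmxA.
Qed.

Lemma bform0l A v : bform A 0 v = 0.
Proof. by rewrite /bform !mul0mx mxE. Qed.

Lemma bform0r A v : bform A v 0 = 0.
Proof. by rewrite /bform linear0 mulmx0 mxE. Qed.

Lemma bform_delta A i j : bform A (delta_mx 0 i) (delta_mx 0 j) = A i j.
Proof. by rewrite /bform -rowE trmx_delta -colE !mxE. Qed.

Lemma bform_mul A u v : bform A u v = bform 1%:M (u *m A) v.
Proof. by rewrite /bform mulmx1. Qed.

Lemma bform_row0 u : (forall v, bform 1%:M u v = 0) -> u = 0.
Proof.
move=> h; apply/rowP => i; have := h (delta_mx 0 i).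
by rewrite /bform mulmx1 trmx_delta -colE !mxE.
Qed.

Lemma bform_mulP A B u w : (forall v, bform A u v = bform B w v) -> u *m A = w *m B.
Proof.
move=> h; apply/eqP; rewrite -subr_eq0; apply/eqP/bform_row0 => v.
by rewrite bformDl bformNl -!bform_mul h subrr.
Qed.

Lemma bform_mxP A B : (forall u v, bform A u v = bform B u v) -> A = B.
Proof. by move=> h; apply/matrixP => i j; have := h (delta_mx 0 i) (delta_mx 0 j); rewrite !bform_delta. Qed.
End Bform.

Definition bformE := (bformDl, bformDr, bformZl, bformZr, bformNl, bformNr,
  bform_addm, bform_scalem, bform_oppm, bform0l, bform0r).

(** * Rank, genericity and exterior squares of matrices *)

Section Cartan.
Variables (R : realFieldType) (n : nat).
Implicit Types (A B D G : 'M[R]_n) (X Y Z W : 'rV[R]_n) (a b c d : R).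

Lemma mul_cols (s : seq 'rV[R]_n) Y (j : 'I_(size s)) :
  (Y *m \matrix_(i < n, j < size s) (s`_j) 0 i) 0 j = bform 1%:M s`_j Y.
Proof.
by rewrite /bform mulmx1 !mxE; apply: eq_bigr => i _; rewrite !mxE mulrC.
Qed.

Lemma common_orthogonal (s : seq 'rV[R]_n) : (size s < n)%N ->
  exists2 Y : 'rV[R]_n, Y != 0 & forall r, r \in s -> bform 1%:M r Y = 0.
Proof.
move=> hs; pose M := \matrix_(i < n, j < size s) (s`_j) 0 i : 'M[R]_(n, size s).
have : kermx M != 0.
  by rewrite kermx_eq0 -row_leq_rank -ltnNge (leq_ltn_trans (rank_leq_col _)).
case/rowV0Pn => Y /sub_kermxP YM Y0; exists Y => // r /(nthP 0)[j js <-].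
by rewrite -(mul_cols Y (Ordinal js)) -/M YM mxE.
Qed.

(** The kernel of [A] contains the orthogonal complement of [s], whose codimension is at most
    [size s]. *)
Lemma rank_le_orthogonal A (s : seq 'rV[R]_n) :
  (forall Y, (forall r, r \in s -> bform 1%:M r Y = 0) -> Y *m A = 0) ->
  (\rank A <= size s)%N.
Proof.
move=> h; pose M := \matrix_(i < n, j < size s) (s`_j) 0 i : 'M[R]_(n, size s).
suff : (kermx M <= kermx A)%MS.
  move/mxrankS; rewrite !mxrank_ker => hr.
  have := rank_leq_col M; have := rank_leq_row A; have := rank_leq_row M; lia.
apply/rV_subP => Y /sub_kermxP YM; apply/sub_kermxP/h => r /(nthP 0)[j js <-].
by rewrite -(mul_cols Y (Ordinal js)) -/M YM mxE.
Qed.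

(* The polynomial functions on lines are closed under products, so the set of
   points where finitely many of them are nonzero is nonempty as soon as each
   of them is nonzero somewhere. *)
Definition line_poly (q : 'rV[R]_n -> R) : Prop :=
  forall X Y, exists p : {poly R}, forall t, q (X + t *: Y) = p.[t].

Lemma line_polyM q1 q2 :
  line_poly q1 -> line_poly q2 -> line_poly (fun X => q1 X * q2 X).
Proof.
move=> h1 h2 X Y; have [p1 e1] := h1 X Y; have [p2 e2] := h2 X Y.
by exists (p1 * p2) => t; rewrite hornerM e1 e2.
Qed.

(** In characteristic zero the integers below [size p] are distinct, and they are too many to be all
    roots. *)
Lemma poly_nonroot (p : {poly R}) : p != 0 -> exists t, p.[t] != 0.
Proof.
move=> p0; pose s := [seq (i%:R : R) | i <- iota 0 (size p)].
have us : uniq s by rewrite map_inj_uniq ?iota_uniq //; exact/mulrIn/oner_neq0.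
case: (boolP (all (root p) s)) => [hall|/allPn[t _ ht]]; last by exists t.
by have := max_poly_roots p0 hall us; rewrite size_map size_iota ltnn.
Qed.

Lemma line_poly_meet q1 q2 X1 X2 : line_poly q1 -> line_poly q2 ->
  q1 X1 != 0 -> q2 X2 != 0 -> exists X, q1 X * q2 X != 0.
Proof.
move=> h1 h2 n1 n2.
have [p1 e1] := h1 X1 (X2 - X1); have [p2 e2] := h2 X1 (X2 - X1).
have p10 : p1 != 0.
  by apply: contraNneq n1 => p0; have := e1 0; rewrite scale0r addr0 p0 horner0 => ->.
have p20 : p2 != 0.
  by apply: contraNneq n2 => p0; have := e2 1; rewrite scale1r addrC subrK p0 horner0 => ->.
have [t ht] := poly_nonroot (mulf_neq0 p10 p20).
by exists (X1 + t *: (X2 - X1)); rewrite e1 e2 -hornerM.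
Qed.

(** All these 2 x 2 minors vanish when [X *m P] is a multiple of [X *m Q], so one nonzero minor
    certifies that [X] is not an eigenvector of [P] relative to [Q]. *)
Lemma line_poly_minor (P Q : 'M[R]_n) (i j : 'I_n) : line_poly (fun X : 'rV[R]_n =>
  (X *m P) 0 i * (X *m Q) 0 j - (X *m P) 0 j * (X *m Q) 0 i).
Proof.
move=> X Y.
exists (((X *m P) 0 i)%:P * ((X *m Q) 0 j)%:P - ((X *m P) 0 j)%:P * ((X *m Q) 0 i)%:P
  + 'X * (((X *m P) 0 i)%:P * ((Y *m Q) 0 j)%:P + ((Y *m P) 0 i)%:P * ((X *m Q) 0 j)%:P
    - ((X *m P) 0 j)%:P * ((Y *m Q) 0 i)%:P - ((Y *m P) 0 j)%:P * ((X *m Q) 0 i)%:P)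
  + 'X^2 * (((Y *m P) 0 i)%:P * ((Y *m Q) 0 j)%:P - ((Y *m P) 0 j)%:P * ((Y *m Q) 0 i)%:P)).
move=> t; rewrite !mulmxDl -!scalemxAl !mxE !hornerE; ring.
Qed.

(** Every vector is an eigenvector: on basis vectors this kills the off-diagonal entries, on sums of
    two of them it equates the diagonal ones. *)
Lemma scalar_mx_minors (P : 'M[R]_n) :
  (forall (Y : 'rV[R]_n) i j, (Y *m P) 0 i * Y 0 j = (Y *m P) 0 j * Y 0 i) ->
  exists l, P = l%:M.
Proof.
move=> h.
have offdiag i k : i != k -> P i k = 0.
  move=> ik; have := h (delta_mx 0 i) k i.
  by rewrite -rowE !mxE !eqxx (eq_sym k) (negPf ik) /= mulr1 mulr0.
have diag i j : i != j -> P i i = P j j.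
  move=> ij; have := h (delta_mx 0 i + delta_mx 0 j) i j.
  rewrite mulmxDl -!rowE !mxE !eqxx (eq_sym j) (negPf ij).
  rewrite (offdiag _ _ ij) (offdiag j i) 1?eq_sym //.
  by rewrite /= !(addr0, add0r, mulr1).
case: (pickP (fun _ : 'I_n => true)) => [i0 _|noI]; last first.
  by exists 0; apply/matrixP => i; have := noI i.
exists (P i0 i0); apply/matrixP => i j; rewrite !mxE.
by case: eqVneq => [<-|/offdiag ->//]; case: (eqVneq i i0) => [->//|/diag ->].
Qed.

Lemma neq_scalar_minor (G P : 'M[R]_n) : G \in unitmx -> (forall l, P <> l *: G) ->
  exists (X : 'rV[R]_n) (i j : 'I_n),
    (X *m P) 0 i * (X *m G) 0 j - (X *m P) 0 j * (X *m G) 0 i != 0.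
Proof.
move=> Gu nP; apply: contrapT => noX.
suff [l] : exists l, invmx G *m P = l%:M.
  move/(congr1 (mulmx G)); rewrite mulKVmx // mul_mx_scalar; exact: nP.
apply: scalar_mx_minors => Y i j; apply: contrapT => hY; apply: noX.
exists (Y *m invmx G), i, j; rewrite -mulmxA mulmxKV // subr_eq0.
exact/eqP.
Qed.

Lemma mul_minor0 (u v : 'rV[R]_n) (l : R) i j :
  u = l *: v -> u 0 i * v 0 j - u 0 j * v 0 i = 0.
Proof. by move->; rewrite !mxE; ring. Qed.

Lemma generic_noneigen (G P1 P2 P3 : 'M[R]_n) : G \in unitmx ->
  (forall l, P1 <> l *: G) -> (forall l, P2 <> l *: G) -> (forall l, P3 <> l *: G) ->
  exists X : 'rV[R]_n, [/\ forall l, X *m P1 <> l *: (X *m G),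
    forall l, X *m P2 <> l *: (X *m G) & forall l, X *m P3 <> l *: (X *m G)].
Proof.
move=> Gu n1 n2 n3.
have [X1 [i1 [j1 m1]]] := neq_scalar_minor Gu n1.
have [X2 [i2 [j2 m2]]] := neq_scalar_minor Gu n2.
have [X3 [i3 [j3 m3]]] := neq_scalar_minor Gu n3.
pose q P i j := fun X : 'rV[R]_n =>
  (X *m P) 0 i * (X *m G) 0 j - (X *m P) 0 j * (X *m G) 0 i.
have lq P i j : line_poly (q P i j) by exact: line_poly_minor.
have [Y mY] := line_poly_meet (lq P1 i1 j1) (lq P2 i2 j2) m1 m2.
have [X] := line_poly_meet (line_polyM (lq P1 i1 j1) (lq P2 i2 j2)) (lq P3 i3 j3) mY m3.
rewrite !mulf_eq0 !negb_or => /andP[/andP[q1 q2] q3]; exists X.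
split=> l /mul_minor0 e.
- by move: q1; rewrite /q e eqxx.
- by move: q2; rewrite /q e eqxx.
- by move: q3; rewrite /q e eqxx.
Qed.

Lemma mxrank_le1 (A : 'M[R]_n) :
  (forall X Y Z W, bform A X Z * bform A Y W = bform A X W * bform A Y Z) ->
  (\rank A <= 1)%N.
Proof.
move=> h; case: (eqVneq A 0) => [->|A0]; first by rewrite mxrank0.
have /existsP[i /existsP[j Aij]] : [exists i, exists j, A i j != 0].
  apply: contraNT A0 => /existsPn h'; apply/eqP/matrixP => i j.
  by move/existsPn/(_ j): (h' i); rewrite negbK mxE => /eqP.
apply: (@rank_le_orthogonal A [:: (delta_mx 0 j *m A^T)]) => Y hY.
apply: bform_row0 => Z; rewrite -bform_mul; apply: (mulfI Aij).
rewrite mulr0 -(bform_delta A) h; suff -> : bform A Y (delta_mx 0 j) = 0 by rewrite mulr0.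
have := hY _ (mem_head _ _); rewrite -bform_mul /bform => <-.
by rewrite -[in RHS](trmxK (_ *m Y^T)) [in RHS]mxE !trmx_mul !trmxK mulmxA.
Qed.

(** The argument behind the Beez-Killing theorem: [B] vanishes wherever [A] does, hence is a
    multiple [c] of [A], and the exterior squares give [c ^+ 2 = 1]. The conclusion is stated on
    products, where the sign of [c] disappears. *)
Lemma exterior_square_inj (A B : 'M[R]_n) : A^T = A -> B^T = B -> (3 <= \rank A)%N ->
  (forall X Y Z W, bform A X Z * bform A Y W - bform A X W * bform A Y Z =
                   bform B X Z * bform B Y W - bform B X W * bform B Y Z) ->
  forall X Y Z W, bform A X Y * bform A Z W = bform B X Y * bform B Z W.
Proof.
move=> symA symB rA h.
have ker Y : Y *m B = 0 -> Y *m A = 0.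
  move=> YB; apply: contrapT => YA.
  have B0 W : bform B Y W = 0 by rewrite /bform YB mul0mx mxE.
  have [W AYW] : exists W, bform A Y W != 0.
    apply: contrapT => hW; apply: YA; apply: bform_row0 => W; rewrite -bform_mul.
    by apply/eqP; apply: contraT => nW; case: hW; exists W.
  suff : (\rank A <= 1)%N by lia.
  apply: (@rank_le_orthogonal A [:: Y *m A]) => Z hZ.
  apply: bform_row0 => V; rewrite -bform_mul.
  have := h Z Y V W; rewrite !B0 !mulr0 subrr => /eqP.
  have := hZ _ (mem_head _ _); rewrite -bform_mul (bformC _ _ symA) => AZY.
  rewrite subr_eq0 => /eqP e.
  have := h Y Z W V; rewrite !B0 !mul0r subrr => /eqP.
  have := h Y V Z W; rewrite !B0 !mul0r subrr (bformC Y Z symA) AZY mul0r sub0r.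
  move/eqP; rewrite oppr_eq0 mulf_eq0 (negPf AYW) /= => /eqP.
  by rewrite (bformC _ _ symA).
have rB : (3 <= \rank B)%N.
  suff : (kermx B <= kermx A)%MS.
    move/mxrankS; rewrite !mxrank_ker => hr.
    have := rank_leq_row A; have := rank_leq_row B; lia.
  by apply/rV_subP => Y /sub_kermxP YB; apply/sub_kermxP/ker.
(* If A X W = 0, the hypothesis expresses B X W * B as a sum of two forms of
   rank one, so that B X W != 0 would give B rank at most two. *)
have zero X W : bform A X W = 0 -> bform B X W = 0.
  move=> AXW; apply: contrapT => /eqP BXW.
  suff : (\rank B <= 2)%N by lia.
  apply: (@rank_le_orthogonal B [:: W *m A; W *m B]) => Y hY.
  have YA : bform A Y W = 0 by rewrite (bformC _ _ symA) bform_mul hY // mem_head.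
  have YB : bform B Y W = 0 by rewrite (bformC _ _ symB) bform_mul hY // !inE eqxx orbT.
  apply: bform_row0 => Z; rewrite -bform_mul.
  have := h X Y Z W; rewrite AXW YA YB !mulr0 mul0r subrr sub0r => /eqP.
  by rewrite eq_sym oppr_eq0 mulf_eq0 (negPf BXW) => /eqP.
(* For fixed [X] the linear form [bform B X] vanishes on the kernel of [bform A X]; the vector used
   here lies in that kernel. *)
have cross1 X W W' : bform B X W * bform A X W' = bform A X W * bform B X W'.
  have /zero : bform A X (bform A X W' *: W - bform A X W *: W') = 0 by rewrite !bformE; ring.
  by rewrite !bformE => e; apply/eqP; rewrite -subr_eq0 -e; apply/eqP; ring.
have cross2 X X' W : bform B X W * bform A X' W = bform A X W * bform B X' W.
  by rewrite !(bformC _ W symA) !(bformC _ W symB) cross1.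
have cross3 X X' W W' : bform A X W' != 0 ->
    bform B X W * bform A X' W' = bform A X W * bform B X' W'.
  move=> n2; apply: (mulfI n2); have e1 := cross1 X W W'; have e2 := cross2 X X' W'.
  by rewrite mulrA (mulrC (bform A X W')) e1 -mulrA e2; ring.
have [X0 [W0 A0]] : exists X0 W0, bform A X0 W0 != 0.
  apply: contrapT => hW; suff A0 : A = 0 by move: rA; rewrite A0 mxrank0.
  apply: bform_mxP => X W; rewrite [RHS]/bform mulmx0 mul0mx mxE.
  by apply/eqP; apply: contraT => nW; case: hW; exists X, W.
(* The pair [(X, W)] is compared with [(X0, W0)] through [(X, W0)] or [(X0, W)]. If [A] vanishes on
   both of these, [X + X0] takes the place of [X]. *)
have BcA X W : bform B X W * bform A X0 W0 = bform A X W * bform B X0 W0.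
  have [AXW|nAXW] := eqVneq (bform A X W) 0; first by rewrite AXW zero // !mul0r.
  have [AXW0|nAXW0] := eqVneq (bform A X W0) 0; last exact: cross3.
  have [AX0W|nAX0W] := eqVneq (bform A X0 W) 0.
    have := cross1 (X + X0) W W0.
    by rewrite !bformE AXW0 AX0W (zero _ _ AXW0) (zero _ _ AX0W) !(addr0, add0r).
  by rewrite mulrC -(cross3 X0 X W0 W) // mulrC.
pose c := bform B X0 W0 / bform A X0 W0.
have Bc X W : bform B X W = c * bform A X W.
  by apply: (mulIf A0); rewrite BcA /c; field.
have c2 : c ^+ 2 = 1.
  apply: contrapT => /eqP c2; suff : (\rank A <= 1)%N by lia.
  apply: mxrank_le1 => X Y Z W; have := h X Y Z W; rewrite !Bc => e.
  apply/eqP; rewrite -subr_eq0; have : c ^+ 2 - 1 != 0 by rewrite subr_eq0.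
  move/mulfI; move/(_ (bform A X Z * bform A Y W - bform A X W * bform A Y Z) 0).
  by move=> ->//; rewrite mulr0 mulrBl mul1r [X in _ - X]e; ring.
move=> X Y Z W; rewrite !Bc; transitivity (c ^+ 2 * (bform A X Y * bform A Z W)); last by ring.
by rewrite c2 mul1r.
Qed.
End Cartan.

(** * Eigenvectors of flat bilinear forms *)

Section Flat.
Variables (R : realFieldType) (n : nat).
Variables (A B D G : 'M[R]_n).
Implicit Types (X Y Z W : 'rV[R]_n).
Hypotheses (n_ge5 : (5 <= n)%N).
Hypotheses (symA : A^T = A) (symB : B^T = B) (symD : D^T = D) (symG : G^T = G).
Hypothesis defG : forall Y : 'rV[R]_n, Y != 0 -> bform G Y Y != 0.
(* No eigenvalue of A with respect to G has multiplicity above n - 3. *)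
Hypothesis rankA : forall a, (3 <= \rank (A - a *: G)%R)%N.
(* The curvature-like tensors of A and B differ by the Kulkarni-Nomizu product
   of D and G. *)
Hypothesis flat : forall X Y Z W : 'rV[R]_n,
  bform A X Z * bform A Y W - bform A X W * bform A Y Z
  - (bform B X Z * bform B Y W - bform B X W * bform B Y Z) =
  bform D X Z * bform G Y W + bform G X Z * bform D Y W
  - bform D X W * bform G Y Z - bform G X W * bform D Y Z.

Lemma definite_unitmx : G \in unitmx.
Proof.
rewrite -row_free_unit -kermx_eq0; apply: contraT => /rowV0Pn[Y /sub_kermxP YG Y0].
by have := defG Y0; rewrite /bform YG mul0mx mxE eqxx.
Qed.

(** Moore's observation: if the form with values in the quadratic space vanishes on (X, Y), then
    flatness makes its values on (X, W) and on (Y, Z) orthogonal for all Z and W. The argument W is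
    dropped, which leaves a linear relation between rows. *)
Lemma flat_relation X Y : bform A X Y = 0 -> bform B X Y = 0 -> bform D X Y = 0 ->
  bform G X Y = 0 -> forall Z,
  bform A Y Z *: (X *m A) - bform B Y Z *: (X *m B) =
  bform D Y Z *: (X *m G) + bform G Y Z *: (X *m D).
Proof.
move=> a0 b0 d0 g0 Z; apply/eqP; rewrite -subr_eq0; apply/eqP/bform_row0 => W.
have := flat X Z Y W; rewrite a0 b0 d0 g0 !bformE -!bform_mul.
rewrite !(bformC Z Y) // => /eqP; rewrite -subr_eq0 => /eqP e.
by apply/eqP; rewrite -oppr_eq0 -e; apply/eqP; ring.
Qed.

(** Four linear conditions on at least five unknowns; the bound on the dimension enters through this
    count. *)
Lemma joint_orthogonal X : exists2 Y, Y != 0 &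
  [/\ bform A X Y = 0, bform B X Y = 0, bform D X Y = 0 & bform G X Y = 0].
Proof.
have [|Y Y0 oY] := @common_orthogonal R n [:: X *m A; X *m B; X *m D; X *m G].
  exact: n_ge5.
by exists Y => //; split; rewrite bform_mul oY // !inE eqxx ?orbT.
Qed.

(** In [flat_relation] with [Z = Y] the coefficient of [X *m D] is [bform G Y Y], which is nonzero
    because [G] is definite. *)
Lemma flat_span X : exists x y z,
  X *m D = x *: (X *m G) + y *: (X *m A) + z *: (X *m B).
Proof.
have [Y Y0 [a0 b0 d0 g0]] := joint_orthogonal X.
have e := flat_relation a0 b0 d0 g0 Y; have c0 := defG Y0.
exists (- bform D Y Y / bform G Y Y), (bform A Y Y / bform G Y Y),
  (- bform B Y Y / bform G Y Y).
apply: (scalerI c0); apply/rowP => i; move/rowP/(_ i): e; rewrite !mxE => e.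
apply: (addrI (bform D Y Y * (X *m G) 0 i)); rewrite !mxE -e.
by field.
Qed.

(* The last condition says that (a, b, d, 1) is a null vector. *)
Definition good_eigenvector (Y : 'rV[R]_n) : Prop := Y <> 0 /\ exists a b d,
  [/\ Y *m A = a *: (Y *m G), Y *m B = b *: (Y *m G), Y *m D = d *: (Y *m G)
    & a ^+ 2 - b ^+ 2 = 2 * d].

Definition indep3 (u v w : 'rV[R]_n) := forall x y z,
  x *: u + y *: v + z *: w = 0 -> [/\ x = 0, y = 0 & z = 0].

(** Once [X *m D] is eliminated by [flat_span], the relation for an orthogonal [Y] has independent
    rows, so each coefficient vanishes; these three equations say that [Y] is a common
    eigenvector. *)
Lemma indep3_eigenvector X : indep3 (X *m G) (X *m A) (X *m B) ->
  exists Y, good_eigenvector Y.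
Proof.
move=> ind.
have [Y Y0 [a0 b0 d0 g0]] := joint_orthogonal X.
have h := flat_relation a0 b0 d0 g0; have c0 := defG Y0.
have [x [y [z XD]]] := flat_span X.
have AYZ Z : [/\ bform D Y Z + bform G Y Z * x = 0, bform G Y Z * y - bform A Y Z = 0 &
    bform G Y Z * z + bform B Y Z = 0].
  apply: ind; have := h Z; rewrite XD => /eqP; rewrite -subr_eq0 => /eqP e.
  apply/rowP => i; move/rowP/(_ i): e; rewrite !mxE => e.
  by move: e; lra.
have YA : Y *m A = y *: (Y *m G).
  rewrite scalemxAr; apply: bform_mulP => Z; have [_ + _] := AYZ Z.
  by rewrite bformE; lra.
have YB : Y *m B = (- z) *: (Y *m G).
  rewrite scalemxAr; apply: bform_mulP => Z; have [_ _] := AYZ Z.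
  by rewrite bformE; lra.
have YD : Y *m D = (- x) *: (Y *m G).
  rewrite scalemxAr; apply: bform_mulP => Z; have [+ _ _] := AYZ Z.
  by rewrite bformE; lra.
exists Y; split; first exact/eqP; exists y, (- z), (- x); split=> //.
(* Nullity comes from the same elimination for [X + Y]: pairing it with [Y] gives one equation, the
   part along [X] shows that the coefficients are those of [X], and together they give
   [- 2 x = y ^ 2 - z ^ 2]. *)
have [x' [y' [z' XYD]]] := flat_span (X + Y).
have e : X *m D + Y *m D = x' *: (X *m G + Y *m G) + y' *: (X *m A + Y *m A)
    + z' *: (X *m B + Y *m B) by rewrite -!mulmxDl.
rewrite YA YB YD XD in e.
have := congr1 (fun u => bform 1%:M u Y) e.
rewrite !bformE -!bform_mul a0 b0 g0 => pair.
have dE : - x = x' + y' * y - z' * z by apply: (mulIf c0); move: pair; lra.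
have [|] := ind (x - x') (y - y') (z - z').
  apply/rowP => i; move/rowP/(_ i): e.
  have : (- x - (x' + y' * y - z' * z)) * (Y *m G) 0 i = 0 by rewrite dE subrr mul0r.
  by rewrite !mxE; lra.
move=> ex ey ez; have ex' : x' = x by lra.
have ey' : y' = y by lra. have ez' : z' = z by lra.
by move: dE; rewrite ex' ey' ez'; lra.
Qed.
Lemma noneigen_indep X : (forall l, X *m A <> l *: (X *m G)) ->
  forall x y, x *: (X *m G) + y *: (X *m A) = 0 -> x = 0 /\ y = 0.
Proof.
move=> nX x y e; have y0 : y = 0.
  apply: contrapT => /eqP y0; apply: (nX (- x / y)); apply: (scalerI y0).
  apply/rowP => i; move/rowP/(_ i): e; rewrite !mxE => e.
  by rewrite mulrA mulrCA mulfV // mulr1; lra.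
split=> //; apply: contrapT => /eqP x0; apply: (nX 0).
move: e; rewrite y0 !scale0r addr0 => /(congr1 (mulmx^~ (invmx G))).
rewrite -scalemxAl mulmxK ?definite_unitmx // mul0mx => /eqP.
by rewrite scaler_eq0 (negPf x0) => /eqP ->; rewrite mul0mx.
Qed.

(** When [X *m B] depends on the other two rows, so does [X *m D]. A vector orthogonal to [X] for
    [A] and [G] is then orthogonal for [B] and [D] as well: two conditions replace four. *)
Lemma dependent_relation X s t : (forall l, X *m A <> l *: (X *m G)) ->
  X *m B = s *: (X *m A) + t *: (X *m G) ->
  exists p q, X *m D = p *: (X *m A) + q *: (X *m G) /\
    forall Y, bform A X Y = 0 -> bform G X Y = 0 ->
    Y *m A = s *: (Y *m B) + p *: (Y *m G) /\
    Y *m D = - t *: (Y *m B) - q *: (Y *m G).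
Proof.
move=> nX XB; have [x [y [z XD]]] := flat_span X.
pose p := y + z * s; pose q := x + z * t.
have XD' : X *m D = p *: (X *m A) + q *: (X *m G).
  by apply/rowP => i; rewrite XD XB /p /q !mxE; ring.
exists p, q; split=> // Y a0 g0.
have b0 : bform B X Y = 0 by rewrite bform_mul XB !bformE -!bform_mul a0 g0; ring.
have d0 : bform D X Y = 0 by rewrite bform_mul XD' !bformE -!bform_mul a0 g0; ring.
have h Z : - (t * bform B Y Z + bform D Y Z + q * bform G Y Z) = 0 /\
    bform A Y Z - s * bform B Y Z - p * bform G Y Z = 0.
  apply: (noneigen_indep nX); have := flat_relation a0 b0 d0 g0 Z.
  by rewrite XB XD' => e; apply/rowP => i; move/rowP/(_ i): e; rewrite !mxE; lra.
split; rewrite !scalemxAr -?mulmxBr -?mulmxDr; apply: bform_mulP => Z; rewrite !bformE.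
  by have [_] := h Z; lra.
by have [+ _] := h Z; lra.
Qed.

Lemma dependent_eigenvector s t X Z a : (forall X, ~ indep3 (X *m G) (X *m A) (X *m B)) ->
  (forall l, X *m A <> l *: (X *m G)) -> s != 0 ->
  X *m B = s *: (X *m A) + t *: (X *m G) ->
  bform A X Z = 0 -> bform G X Z = 0 -> Z != 0 -> Z *m A = a *: (Z *m G) ->
  good_eigenvector Z.
Proof.
move=> dep nX s0 XB a0 g0 Z0 ZA; have c0 := defG Z0.
have [p [q [XD h]]] := dependent_relation nX XB.
have [ZA' ZD] := h Z a0 g0.
pose b := (a - p) / s; pose d := - t * b - q.
have ZB : Z *m B = b *: (Z *m G).
  apply: (scalerI s0); apply/rowP => i; move/rowP/(_ i): ZA'.
  have : s * b * (Z *m G) 0 i = (a - p) * (Z *m G) 0 i by congr (_ * _); rewrite /b mulrC divfK.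
  by rewrite ZA !mxE; lra.
have {}ZD : Z *m D = d *: (Z *m G).
  by rewrite ZD ZB; apply/rowP => i; rewrite !mxE /d; ring.
have b0 : bform 1%:M (X *m A) Z = 0 by rewrite -bform_mul.
have b1 : bform 1%:M (X *m G) Z = 0 by rewrite -bform_mul.
(* Otherwise [X + Z] would have three independent rows, against [dep]. *)
have bE : b = s * a + t.
  apply: contrapT => nb; apply: (dep (X + Z)) => x y z.
  rewrite !mulmxDl ZA ZB XB => e.
  have := congr1 (fun u => bform 1%:M u Z) e.
  rewrite !bformE -!bform_mul a0 g0 => pair.
  have e1 : x + y * a + z * b = 0 by apply: (mulIf c0); move: pair; lra.
  have [] := noneigen_indep nX (x := x + z * t) (y := y + z * s).
    apply/rowP => i; move/rowP/(_ i): e.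
    have : (x + y * a + z * b) * (Z *m G) 0 i = 0 by rewrite e1 mul0r.
    by rewrite !mxE; lra.
  move=> e2 e3; have z0 : z = 0.
    have nb' : b - (s * a + t) != 0 by rewrite subr_eq0; exact/eqP.
    by apply: (mulIf nb'); nra.
  by split=> //; [move: e2 | move: e3]; rewrite z0; lra.
have dE : d = p * a + q.
  have [x [y [z]]] := flat_span (X + Z); rewrite !mulmxDl ZA ZB ZD XD XB => e.
  have := congr1 (fun u => bform 1%:M u Z) e.
  rewrite !bformE -!bform_mul a0 g0 => pair.
  have e1 : d = x + y * a + z * b by apply: (mulIf c0); move: pair; lra.
  have [] := noneigen_indep nX (x := x + z * t - q) (y := y + z * s - p).
    apply/rowP => i; move/rowP/(_ i): e.
    have : (d - (x + y * a + z * b)) * (Z *m G) 0 i = 0 by rewrite e1 subrr mul0r.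
    by rewrite !mxE; lra.
  by move=> e2 e3; rewrite e1 bE; nra.
split; first exact/eqP; exists a, b, d; split=> //.
(* With [a = s b + p] and [b = s a + t] one gets [a ^ 2 - b ^ 2 = p a - t b], which is the sum of
   the two expressions [p a + q] and [- t b - q] of [d]. *)
have e1 : a = s * b + p by rewrite /b mulrC divfK //; ring.
have e2 : d = - t * b - q by [].
have e3 : a * a = a * (s * b + p) by rewrite -e1.
have e4 : b * b = b * (s * a + t) by rewrite -bE.
by move: e2 e3 e4 dE; rewrite !expr2; clearbody b d; lra.
Qed.

(* For generic X the rows X G, X A, X B are independent, or X B = s X A + t X G
   with s^2 != 1.  In the latter case A and B are affine functions of each other
   on the G,A-orthogonal of X, with slope s there and, for a noneigenvector Y of
   A in that space, slope 1/s on the orthogonal of Y; a vector common to both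
   orthogonals, which exists because n >= 5, is an eigenvector. *)
Lemma common_eigenvector : (forall l, B - A <> l *: G) -> (forall l, B + A <> l *: G) ->
  exists Z, good_eigenvector Z.
Proof.
move=> nBA nBA'.
have [[X /indep3_eigenvector//]|dep] := pselect (exists X, indep3 (X *m G) (X *m A) (X *m B)).
have {}dep X : ~ indep3 (X *m G) (X *m A) (X *m B) by move=> h; apply: dep; exists X.
have nA l : A <> l *: G by move=> e; have := rankA l; rewrite -e subrr mxrank0.
have combine X : (forall l, X *m A <> l *: (X *m G)) ->
    exists s t, X *m B = s *: (X *m A) + t *: (X *m G).
  move=> nX; apply: contrapT => nB; apply: (dep X) => x y z e.
  have z0 : z = 0.
    apply: contrapT => /eqP z0; apply: nB; exists (- y / z), (- x / z).
    apply: (scalerI z0); apply/rowP => i; move/rowP/(_ i): e; rewrite !mxE => e.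
    have hz u v : z * (u / z * v) = u * v by field.
    by rewrite mulrDr !hz; lra.
  by move: e; rewrite z0 scale0r addr0 => /(noneigen_indep nX)[].
have [X [nX nX1 nX2]] := generic_noneigen definite_unitmx nA nBA nBA'.
have [s [t XB]] := combine X nX.
have s1 : 1 - s ^+ 2 != 0.
  apply/eqP => e; have : (s - 1) * (s + 1) = 0 by rewrite -[RHS]oppr0 -e; ring.
  move/eqP; rewrite mulf_eq0 => /orP[] /eqP e'.
    by apply: (nX1 t); apply/rowP => i; rewrite mulmxBr XB !mxE; nra.
  by apply: (nX2 t); apply/rowP => i; rewrite mulmxDr XB !mxE; nra.
have [p [q [XD h]]] := dependent_relation nX XB.
(* For [s = 0] the form [A] equals [p G] on a space of codimension at most two, which the rank
   hypothesis forbids. *)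
have s0 : s != 0.
  apply/eqP => s0; have := rankA p; suff : (\rank (A - p *: G)%R <= 2)%N by lia.
  apply: (@rank_le_orthogonal _ _ _ [:: X *m A; X *m G]) => Y oY.
  have [||+ _] := h Y; rewrite 1?bform_mul ?oY ?inE ?eqxx ?orbT // s0 => YA.
  by rewrite mulmxBr YA scale0r add0r -scalemxAr subrr.
have [|Y Y0 oY] := @common_orthogonal R n [:: X *m A; X *m G]; first exact: leq_trans n_ge5.
have aY : bform A X Y = 0 by rewrite bform_mul oY // mem_head.
have gY : bform G X Y = 0 by rewrite bform_mul oY // !inE eqxx orbT.
have [[a YA]|nY] := pselect (exists a, Y *m A = a *: (Y *m G)).
  by exists Y; exact: (dependent_eigenvector dep nX s0 XB aY gY Y0 YA).
have {}nY l : Y *m A <> l *: (Y *m G) by move=> e; apply: nY; exists l.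
have [YA _] := h Y aY gY.
have YB : Y *m B = s^-1 *: (Y *m A) + (- p / s) *: (Y *m G).
  by rewrite YA; apply/rowP => i; rewrite !mxE; field.
have [p' [q' [_ h']]] := dependent_relation nY YB.
have [|Z Z0 oZ] := @common_orthogonal R n [:: X *m A; X *m G; Y *m A; Y *m G].
  exact: leq_trans n_ge5.
have aZ : bform A X Z = 0 by rewrite bform_mul oZ // !inE eqxx ?orbT.
have gZ : bform G X Z = 0 by rewrite bform_mul oZ // !inE eqxx ?orbT.
have aZ' : bform A Y Z = 0 by rewrite bform_mul oZ // !inE eqxx ?orbT.
have gZ' : bform G Y Z = 0 by rewrite bform_mul oZ // !inE eqxx ?orbT.
have [e1 _] := h Z aZ gZ; have [e2 _] := h' Z aZ' gZ'.
(* Elimination of [Z *m B] between the relations of slopes [s] and [s^-1]; it succeeds because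
   [s ^+ 2] differs from 1. *)
have ZA : Z *m A = ((p - s ^+ 2 * p') / (1 - s ^+ 2)) *: (Z *m G).
  apply: (scalerI s1); move: e1 e2; move: (Z *m A) (Z *m B) (Z *m G) => u v w e1 e2.
  apply/rowP => i; move/rowP/(_ i): e1; move/rowP/(_ i): e2; rewrite !mxE => e2 e1.
  have hz x y : (1 - s ^+ 2) * (x / (1 - s ^+ 2) * y) = x * y by field.
  have : s ^+ 2 * u 0 i = s * v 0 i + s ^+ 2 * p' * w 0 i by rewrite e2; field.
  by rewrite hz; lra.
by exists Z; exact: (dependent_eigenvector dep nX s0 XB aZ gZ Z0 ZA).
Qed.
End Flat.

(** This is flatness with [A = B = 0]. By [flat_relation] every [X] is an eigenvector of [E]
    relative to [G], and a vector orthogonal to it has the opposite eigenvalue; hence [E] is a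
    multiple of [G] by a factor equal to its own opposite. *)
Lemma wedge_metric_inj (R : realFieldType) (n : nat) (E G : 'M[R]_n) :
  (5 <= n)%N -> E^T = E -> G^T = G ->
  (forall Y : 'rV[R]_n, Y != 0 -> bform G Y Y != 0) ->
  (forall X Y Z W : 'rV[R]_n,
    bform E X Z * bform G Y W + bform G X Z * bform E Y W
    - bform E X W * bform G Y Z - bform G X W * bform E Y Z = 0) ->
  E = 0.
Proof.
move=> n5 symE symG defG h.
have flat0 (X Y Z W : 'rV[R]_n) :
    bform 0 X Z * bform 0 Y W - bform 0 X W * bform 0 Y Z
    - (bform 0 X Z * bform 0 Y W - bform 0 X W * bform 0 Y Z) =
    bform E X Z * bform G Y W + bform G X Z * bform E Y W
    - bform E X W * bform G Y Z - bform G X W * bform E Y Z.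
  by rewrite h subrr.
have rel (X : 'rV[R]_n) : exists2 Y : 'rV[R]_n, Y != 0 & exists e : R, 
    X *m E = (- e) *: (X *m G) /\ (X != 0 -> Y *m E = e *: (Y *m G)).
  have [Y Y0 [a0 b0 d0 g0]] := joint_orthogonal 0 0 E G n5 X.
  have c0 := defG Y Y0; exists Y => //; exists (bform E Y Y / bform G Y Y).
  have r := @flat_relation _ _ 0 0 E G _ _ _ _ flat0 X Y a0 b0 d0 g0.
  have XE : X *m E = (- (bform E Y Y / bform G Y Y)) *: (X *m G).
    apply: (scalerI c0); have := r (trmx0 _ _ _) (trmx0 _ _ _) symE symG Y.
    rewrite !mulmx0 !scaler0 subr0 => e; apply/rowP => i; move/rowP/(_ i): e.
    move: (X *m G) (X *m E) => u v; rewrite !mxE => e.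
    have -> : bform G Y Y * (- (bform E Y Y / bform G Y Y) * u 0 i) = - bform E Y Y * u 0 i.
      by field.
    by lra.
  split=> // X0; rewrite scalemxAr; apply: bform_mulP => Z; rewrite bformE.
  have := r (trmx0 _ _ _) (trmx0 _ _ _) symE symG Z.
  rewrite !mulmx0 !scaler0 subr0 XE scalerA -scalerDl => /esym/eqP.
  rewrite scaler_eq0 => /orP[/eqP|/eqP XG]; first by lra.
  by have := defG X X0; rewrite /bform XG mul0mx mxE eqxx.
have [[e Ee]|nE] := pselect (exists e, E = e *: G); last first.
  have [|X [i [j]]] := neq_scalar_minor (definite_unitmx defG) (P := E).
    by move=> l el; apply: nE; exists l.
  by have [Y _ [e [XE _]]] := rel X; rewrite (mul_minor0 _ _ XE) eqxx.
have [|X X0 _] := @common_orthogonal R n [::]; first exact: leq_trans n5.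
have [Y Y0 [e' [XE /(_ X0) YE]]] := rel X.
have ce (Z : 'rV[R]_n) (l : R) : Z != 0 -> Z *m E = l *: (Z *m G) -> e = l.
  move=> Z0; rewrite Ee -scalemxAr => /eqP; rewrite -subr_eq0 -scalerBl scaler_eq0 => /orP[].
    by rewrite subr_eq0 => /eqP.
  by move=> /eqP ZG; have := defG Z Z0; rewrite /bform ZG mul0mx mxE eqxx.
have e1 := ce _ _ X0 XE; have e2 := ce _ _ Y0 YE.
by rewrite Ee (_ : e = 0) ?scale0r //; lra.
Qed.

Section Cartan.
Variables (R : realFieldType) (n : nat).
Variables (A B D G : 'M[R]_n).
Implicit Types (X Y Z W : 'rV[R]_n).
Hypotheses (n_ge5 : (5 <= n)%N).
Hypotheses (symA : A^T = A) (symB : B^T = B) (symD : D^T = D) (symG : G^T = G).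
Hypothesis defG : forall Y : 'rV[R]_n, Y != 0 -> bform G Y Y != 0.
Hypothesis flat : forall X Y Z W : 'rV[R]_n,
  bform A X Z * bform A Y W - bform A X W * bform A Y Z
  - (bform B X Z * bform B Y W - bform B X W * bform B Y Z) =
  bform D X Z * bform G Y W + bform G X Z * bform D Y W
  - bform D X W * bform G Y Z - bform G X W * bform D Y Z.

Lemma flat_null_scalar s l : s ^+ 2 = 1 -> B = s *: A + l *: G -> forall X Y Z W,
  bform A X Y * bform A Z W - bform B X Y * bform B Z W =
  bform D X Y * bform G Z W + bform G X Y * bform D Z W.
Proof.
move=> s2 BE.
(* Expanding the curvature term of [B] turns flatness into the vanishing of the Kulkarni-Nomizu
   product of this form with [G]. The factor one half is there because the product of [G] with
   itself counts each term twice. *)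
have E0 : D + (s * l) *: A + (l ^+ 2 / 2) *: G = 0.
  apply: (wedge_metric_inj n_ge5 _ symG defG).
    by rewrite !linearD !linearZ /= symD symA symG.
  move=> X Y Z W; have := flat X Y Z W; rewrite BE !bformE => e.
  apply/eqP; rewrite -subr_eq0; apply/eqP; move/eqP: e; rewrite -subr_eq0 => /eqP e.
  rewrite -[RHS]oppr0 -[in RHS]e.
  transitivity ((s ^+ 2 - 1) *
    (bform A X W * bform A Y Z - bform A X Z * bform A Y W) +
    - (bform A X Z * bform A Y W - bform A X W * bform A Y Z -
   ((s * bform A X Z + l * bform G X Z) * (s * bform A Y W + l * bform G Y W) -
    (s * bform A X W + l * bform G X W) * (s * bform A Y Z + l * bform G Y Z)) -
   (bform D X Z * bform G Y W + bform G X Z * bform D Y W -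
    bform D X W * bform G Y Z - bform G X W * bform D Y Z))); first by field.
  by rewrite s2; ring.
have DE : D = - ((s * l) *: A) - (l ^+ 2 / 2) *: G.
  by apply/eqP; rewrite -subr_eq0 -E0; apply/eqP; rewrite !opprB !opprK; apply/matrixP => i j; rewrite !mxE; ring.
move=> X Y Z W; rewrite DE BE !bformE.
transitivity ((s ^+ 2 - 1) * (- bform A X Y * bform A Z W) +
  ((-(s * l * bform A X Y) - l ^+ 2 / 2 * bform G X Y) * bform G Z W +
  bform G X Y * (-(s * l * bform A Z W) - l ^+ 2 / 2 * bform G Z W))); first by field.
by rewrite s2; ring.
Qed.

(* The pointwise core of Cartan's conformal rigidity theorem. *)
Lemma flat_null : (forall a, (3 <= \rank (A - a *: G)%R)%N) -> forall X Y Z W,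
  bform A X Y * bform A Z W - bform B X Y * bform B Z W =
  bform D X Y * bform G Z W + bform G X Y * bform D Z W.
Proof.
move=> rankA.
have [[l e]|n1] := pselect (exists l, B - A = l *: G).
  apply: (@flat_null_scalar 1 l); first by rewrite expr1n.
  by rewrite scale1r -e addrC subrK.
have [[l e]|n2] := pselect (exists l, B + A = l *: G).
  apply: (@flat_null_scalar (-1) l); first by rewrite sqrrN expr1n.
  by rewrite scaleN1r -e addrC addrK.
have [||] := common_eigenvector n_ge5 symA symB symD symG defG rankA flat.
- by move=> l e; apply: n1; exists l.
- by move=> l e; apply: n2; exists l.
move=> Y [/eqP Y0 [a [b [d [YA YB YD abd]]]]]; have c0 := defG Y0.
have dE : d = (a ^+ 2 - b ^+ 2) / 2 by rewrite abd; field.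
have AY Z : bform A Y Z = a * bform G Y Z by rewrite /bform YA -scalemxAl mxE.
have BY Z : bform B Y Z = b * bform G Y Z by rewrite /bform YB -scalemxAl mxE.
have DY Z : bform D Y Z = d * bform G Y Z by rewrite /bform YD -scalemxAl mxE.
(* Flatness evaluated with [Y] in one slot of each pair determines [D]. *)
have DE X Z : bform D X Z = a * bform A X Z - b * bform B X Z - d * bform G X Z.
  apply: (mulIf c0); have := flat X Y Z Y.
  rewrite !(bformC X Y) // !AY !BY !DY dE; lra.
(* Substituting [D] into flatness completes the squares: the mixed terms are absorbed by the shifts
   [a *: G] and [b *: G]. *)
have wedge X Z W V : bform (A - a *: G) X W * bform (A - a *: G) Z V -
   bform (A - a *: G) X V * bform (A - a *: G) Z W =
   bform (B - b *: G) X W * bform (B - b *: G) Z V -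
   bform (B - b *: G) X V * bform (B - b *: G) Z W.
  by have := flat X Z W V; rewrite !DE dE !bformE; lra.
have symS P c : P^T = P -> (P - c *: G)^T = P - c *: G.
  by move=> symP; rewrite linearB linearZ /= symP symG.
move=> X X' Z W; have := exterior_square_inj (symS A a symA) (symS B b symB) (rankA a) wedge X X' Z W.
by rewrite !DE dE !bformE; lra.
Qed.
End Cartan.

Local Open Scope classical_set_scope.
Local Open Scope ring_scope.

(** * Differential calculus *)

Section Line.
Variables (R : realType) (V W : normedModType R).

Lemma is_derive_line (f : V -> W) x v t df : is_derive (x + t *: v) v f df ->
  is_derive t 1 (fun s => f (x + s *: v)) df.
Proof.
have E : (fun h => h^-1 *: (((fun s => f (x + s *: v)) \o shift t) (h *: (1 : R)) - f (x + t *: v)))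
  = (fun h => h^-1 *: ((f \o shift (x + t *: v)) (h *: v) - f (x + t *: v))).
  apply/funext => h /=; rewrite [h *: 1]mulr1 scalerDl.
  by rewrite addrCA (addrC (h *: v)) -addrA.
move=> [fv <-]; apply: DeriveDef; first by rewrite /derivable E.
by rewrite /derive E.
Qed.

Lemma diff_approx (f : V -> W) x : differentiable f x -> forall e, 0 < e ->
  exists2 d, 0 < d & forall w, `|w| < d -> `|f (x + w) - f x - 'd f x w| <= e * `|w|.
Proof.
move=> df e e0; have /= E := diff_locallyxC df.
set k : V -> W := 'o_ _ _ in E.
have /(littleoP [littleo of k]) /nbhs_normP[d d0 Hd] := e0.
exists d => // w wd; have := Hd w; rewrite /ball_ /= sub0r normrN => /(_ wd).
by rewrite E -[_ - _ - _]addrA -opprD addrC addKr.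
Qed.

End Line.

(** * Symmetry of second derivatives *)

Section Young.
Variables (R : realType) (V : normedModType R).

(** The mean value theorem in direction [u] is applied to the difference of [phi] along two parallel
    edges, and the resulting difference of values of [Du] is estimated by its differential at the
    single point [x]. *)
Lemma second_difference (phi Du : V -> R) x u v :
  (\near x, is_derive x u phi (Du x)) -> differentiable Du x ->
  forall e, 0 < e -> exists2 d, 0 < d & forall h, 0 < h -> h < d ->
  `|phi (x + h *: u + h *: v) - phi (x + h *: u) - phi (x + h *: v) + phi x
    - h ^+ 2 * 'D_v Du x| <= e * h ^+ 2.
Proof.
move=> /nbhs_normP[r r0 dphi] dDu e e0.
(* Every point considered lies within [h * C] of [x], the summand 1 making this strict. Two
   remainders of at most [e / (2 * C) * (h * C)] add up to [e * h]. *)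
pose C := `|u| + `|v| + 1; have C0 : 0 < C by rewrite /C; have := normr_ge0 u; have := normr_ge0 v; lra.
have e1 : 0 < e / (2 * C) by rewrite divr_gt0 // mulr_gt0.
have [d d0 Hd] := diff_approx dDu e1.
exists (Num.min r d / C); first by rewrite divr_gt0 // lt_min r0.
move=> h h0; rewrite ltr_pdivlMr // lt_min => /andP[hr hd].
(* The boolean selects the edge: [h *+ b] is [h] on the edge through [x + h *: v] and 0 on the edge
   through [x]. *)
have small t (b : bool) : 0 <= t <= h -> `|t *: u + (h *+ b) *: v| < h * C.
  move=> /andP[t0 th]; apply: le_lt_trans (ler_normD _ _) _.
  rewrite !normrZ (ger0_norm t0) (ger0_norm (_ : 0 <= h *+ b)); last exact/mulrn_wge0/ltW.
  have hb : h *+ b <= h by case: b => //=; exact: ltW.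
  have := ler_wpM2r (normr_ge0 u) th; have := ler_wpM2r (normr_ge0 v) hb.
  by rewrite /C !mulrDr mulr1; lra.
have dline t (b : bool) : 0 <= t <= h ->
    is_derive (x + (h *+ b) *: v + t *: u) u phi (Du (x + (h *+ b) *: v + t *: u)).
  move=> th; apply: dphi; rewrite /ball_ /= -(addrA x) opprD addrA subrr add0r normrN addrC.
  by exact: lt_trans (small _ _ th) hr.
pose psi t := phi (x + (h *+ true) *: v + t *: u) - phi (x + (h *+ false) *: v + t *: u).
pose dpsi t := Du (x + (h *+ true) *: v + t *: u) - Du (x + (h *+ false) *: v + t *: u).
have Hpsi t : 0 <= t <= h -> is_derive t 1 psi (dpsi t).
  by move=> th; apply: is_deriveB; exact/is_derive_line/dline.
have [||t th E] := @MVT R psi dpsi 0 h h0.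
- by move=> t; rewrite in_itv /= => /andP[t0 th]; apply: Hpsi; rewrite !ltW.
- apply: derivable_within_continuous => t; rewrite in_itv /= => th.
  by have [] := Hpsi t th.
have {}th : 0 <= t <= h by move: th; rewrite in_itv /= => /andP[? ?]; rewrite !ltW.
have -> : phi (x + h *: u + h *: v) - phi (x + h *: u) - phi (x + h *: v) + phi x = psi h - psi 0.
  rewrite /psi mulr0n mulr1n !scale0r !addr0 (addrAC x) opprB !addrA.
  by rewrite [in RHS]addrAC.
rewrite E subr0 mulrC expr2 -mulrA -mulrBr normrM (gtr0_norm h0) [e * _]mulrCA ler_pM2l //.
have s1 := small t true th; have s0 := small t false th.
have H1 := Hd _ (lt_trans s1 hd); have H0 := Hd _ (lt_trans s0 hd).
have -> : dpsi t - h * 'D_v Du x =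
   (Du (x + (t *: u + (h *+ true) *: v)) - Du x - 'd Du x (t *: u + (h *+ true) *: v))
   - (Du (x + (t *: u + (h *+ false) *: v)) - Du x - 'd Du x (t *: u + (h *+ false) *: v)).
  rewrite (deriveE _ dDu) !linearD !linearZ /= mulr1n mulr0n scale0r addr0 /dpsi.
  rewrite !mulr1n !mulr0n !scale0r !addr0 (addrC (t *: u)) !addrA.
  by rewrite ?addr0 /= /GRing.scale /=; ring.
apply: le_trans (ler_normB _ _) _; apply: le_trans (lerD H1 H0) _.
rewrite -mulrDr; apply: le_trans (_ : e / (2 * C) * (h * C + h * C) <= _).
  by rewrite ler_pM2l // lerD // ltW.
suff -> : e / (2 * C) * (h * C + h * C) = e * h by [].
by field; rewrite gt_eqF.
Qed.

(** The second difference is symmetric in [u] and [v], so it approximates both mixed derivatives. *)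
Lemma young (phi Du Dv : V -> R) x u v :
  (\near x, is_derive x u phi (Du x)) -> (\near x, is_derive x v phi (Dv x)) ->
  differentiable Du x -> differentiable Dv x -> 'D_u Dv x = 'D_v Du x.
Proof.
move=> phiu phiv dDu dDv; apply/eqP; rewrite -subr_eq0 -normr_le0; apply/ler_addgt0Pr => e e0.
have e2 : 0 < e / 2 by rewrite divr_gt0.
have [d1 d10 H1] := second_difference v phiu dDu e2.
have [d2 d20 H2] := second_difference u phiv dDv e2.
pose h := Num.min d1 d2 / 2.
have hm : 0 < Num.min d1 d2 by rewrite lt_min d10.
have h0 : 0 < h by rewrite divr_gt0.
have hlt : h < Num.min d1 d2 by rewrite /h; lra.
move: hlt; rewrite lt_min => /andP[/(H1 _ h0) {}H1 /(H2 _ h0) {}H2].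
have h2 : 0 < h ^+ 2 by rewrite exprn_gt0.
move: H1 H2; rewrite (addrAC x).
move: (phi _) (phi _) (phi _) (phi _) ('D_v _ _) ('D_u _ _) => p1 p2 p3 p4 a b H1 H2.
rewrite add0r -(ler_pM2l h2).
have -> : h ^+ 2 * `|b - a| = `|h ^+ 2 * (b - a)| by rewrite normrM (gtr0_norm h2).
have -> : h ^+ 2 * (b - a) = (p4 - p3 - p2 + p1 - h ^+ 2 * a) - (p4 - p2 - p3 + p1 - h ^+ 2 * b).
  by clear; move: (h ^+ 2) p1 p2 p3 p4 a b => {}h p1 p2 p3 p4 a b; ring.
apply: le_trans (ler_normB _ _) _; apply: le_trans (lerD H1 H2) _.
by rewrite -mulrDl -splitr mulrC.
Qed.
End Young.

(** * Derivatives of matrix-valued functions *)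

Section MatrixValued.
Variables (R : realType) (V : normedModType R).
Implicit Types (x v : V).

Lemma is_derive_bigsum I (r : seq I) (P : pred I) (h : I -> V -> R) (dh : I -> R) x v :
  (forall i, P i -> is_derive x v (h i) (dh i)) ->
  is_derive x v (fun y => \sum_(i <- r | P i) h i y) (\sum_(i <- r | P i) dh i).
Proof.
move=> hd; elim: r => [|i r IH].
  rewrite big_nil (_ : (fun y => _) = cst 0); first exact: is_derive_cst.
  by apply/funext => y; rewrite big_nil.
rewrite big_cons; case: (boolP (P i)) => Pi; last first.
  rewrite (_ : (fun y => _) = (fun y => \sum_(i <- r | P i) h i y)) //.
  by apply/funext => y; rewrite big_cons (negPf Pi).
rewrite (_ : (fun y => _) = h i + (fun y => \sum_(i <- r | P i) h i y)).
  by apply: is_deriveD => //; exact: hd.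
by apply/funext => y; rewrite big_cons Pi.
Qed.

Lemma differentiable_bigsum I (r : seq I) (P : pred I) (h : I -> V -> R) x :
  (forall i, P i -> differentiable (h i) x) ->
  differentiable (fun y => \sum_(i <- r | P i) h i y) x.
Proof.
move=> hd; elim: r => [|i r IH].
  rewrite (_ : (fun y => _) = cst 0); first exact: differentiable_cst.
  by apply/funext => y; rewrite big_nil.
case: (boolP (P i)) => Pi.
  rewrite (_ : (fun y => _) = h i + (fun y => \sum_(i <- r | P i) h i y)).
    by apply: differentiableD => //; exact: hd.
  by apply/funext => y; rewrite big_cons Pi.
rewrite (_ : (fun y => _) = (fun y => \sum_(i <- r | P i) h i y)) //.
by apply/funext => y; rewrite big_cons (negPf Pi).
Qed.

Lemma differentiable_bigprod I (r : seq I) (P : pred I) (h : I -> V -> R) x :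
  (forall i, P i -> differentiable (h i) x) ->
  differentiable (fun y => \prod_(i <- r | P i) h i y) x.
Proof.
move=> hd; elim: r => [|i r IH].
  rewrite (_ : (fun y => _) = cst 1); first exact: differentiable_cst.
  by apply/funext => y; rewrite big_nil.
case: (boolP (P i)) => Pi.
  rewrite (_ : (fun y => _) = h i * (fun y => \prod_(i <- r | P i) h i y)).
    by apply: differentiableM => //; exact: hd.
  by apply/funext => y; rewrite big_cons Pi.
rewrite (_ : (fun y => _) = (fun y => \prod_(i <- r | P i) h i y)) //.
by apply/funext => y; rewrite big_cons (negPf Pi).
Qed.

Definition entrywise_differentiable (p q : nat) (M : V -> 'M[R]_(p, q)) x :=
  forall i j, differentiable (fun y => M y i j) x.

Lemma differentiable_entries p q (M : V -> 'M[R]_(p, q)) x :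
  differentiable M x -> entrywise_differentiable M x.
Proof.
move=> dM i j; rewrite (_ : (fun y => M y i j) = (fun N : 'M[R]_(p, q) => N i j) \o M) //.
by apply: differentiable_comp => //; exact: differentiable_coord.
Qed.

Lemma entrywise_derivable p q (M : V -> 'M[R]_(p, q)) x v :
  entrywise_differentiable M x -> derivable M x v.
Proof. by move=> dM; apply/derivable_mxP => i j; exact/diff_derivable/dM. Qed.

Lemma entrywise_mulmx p q r (M : V -> 'M[R]_(p, q)) (N : V -> 'M[R]_(q, r)) x :
  entrywise_differentiable M x -> entrywise_differentiable N x ->
  entrywise_differentiable (fun y => M y *m N y) x.
Proof.
move=> dM dN i j.
rewrite (_ : (fun y => _) = fun y => \sum_k (M y i k * N y k j)); last first.
  by apply/funext => y; rewrite mxE.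
by apply: differentiable_bigsum => k _; exact: differentiableM.
Qed.

Lemma entrywise_det p (M : V -> 'M[R]_p) x :
  entrywise_differentiable M x -> differentiable (fun y => \det (M y)) x.
Proof.
move=> dM; rewrite /determinant; apply: differentiable_bigsum => s _.
apply: differentiableM; first exact: differentiable_cst.
by apply: differentiable_bigprod => i _; exact: dM.
Qed.

Lemma entrywise_adj p (M : V -> 'M[R]_p) x :
  entrywise_differentiable M x -> entrywise_differentiable (fun y => \adj (M y)) x.
Proof.
move=> dM i j; rewrite (_ : (fun y => _) = fun y => cofactor (M y) j i); last first.
  by apply/funext => y; rewrite mxE.
rewrite /cofactor; apply: differentiableM; first exact: differentiable_cst.
apply: entrywise_det => k l.
rewrite (_ : (fun y => _) = fun y => M y (lift j k) (lift i l)); first exact: dM.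
by apply/funext => y; rewrite !mxE.
Qed.

(** Cramer's formula is a quotient of polynomials in the entries, without the case distinction on
    invertibility made by [invmx]. *)
Lemma entrywise_solve p q (M : V -> 'M[R]_p) (N : V -> 'M[R]_(p, q)) x :
  entrywise_differentiable M x -> entrywise_differentiable N x -> M x \in unitmx ->
  entrywise_differentiable (fun y => (\det (M y))^-1 *: (\adj (M y) *m N y)) x.
Proof.
move=> dM dN Mu i j.
rewrite (_ : (fun y => _) = (fun y => (\det (M y))^-1) * (fun y => (\adj (M y) *m N y) i j)); last first.
  by apply/funext => y; rewrite mxE.
apply: differentiableM; last by apply: entrywise_mulmx => //; exact: entrywise_adj.
apply: differentiableV; first exact: entrywise_det.
by move: Mu; rewrite unitmxE unitfE.
Qed.

Lemma is_derive_entry p q (M : V -> 'M[R]_(p, q)) x v i j : derivable M x v ->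
  is_derive x v (fun y => M y i j) (('D_v M x) i j).
Proof.
move=> dM; rewrite (derive_mx dM) mxE; apply: derivableP.
exact: (derivable_mxP _ _ _).1.
Qed.

Lemma derivable_mulmx p q r (M : V -> 'M[R]_(p, q)) (N : V -> 'M[R]_(q, r)) x v :
  derivable M x v -> derivable N x v -> derivable (fun y => M y *m N y) x v /\
  'D_v (fun y => M y *m N y) x = 'D_v M x *m N x + M x *m 'D_v N x.
Proof.
move=> dM dN.
have entry i j : is_derive x v (fun y => (M y *m N y) i j)
    (('D_v M x *m N x + M x *m 'D_v N x) i j).
  rewrite (_ : (fun y => _) = fun y => \sum_k (M y i k * N y k j)); last first.
    by apply/funext => y; rewrite mxE.
  rewrite !mxE -big_split /=; apply: is_derive_bigsum => k _.
  apply: is_derive_eq; first by apply: is_deriveM; exact: is_derive_entry.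
  by rewrite /GRing.scale /=; ring.
have dMN : derivable (fun y => M y *m N y) x v.
  by apply/derivable_mxP => i j; have [] := entry i j.
by split=> //; rewrite derive_mx //; apply/matrixP => i j; rewrite mxE; have [_ ->] := entry i j.
Qed.

Lemma derive_bform p (J : 'M[R]_p) (f g : V -> 'rV[R]_p) x v :
  derivable f x v -> derivable g x v ->
  is_derive x v (fun y => bform J (f y) (g y))
    (bform J ('D_v f x) (g x) + bform J (f x) ('D_v g x)).
Proof.
move=> df dg.
rewrite (_ : (fun y => _) = fun y => \sum_j \sum_i (J i j * (f y 0 i * g y 0 j))); last first.
  apply/funext => y; rewrite /bform mxE; apply: eq_bigr => j _.
  by rewrite !mxE mulr_suml; apply: eq_bigr => i _; ring.
rewrite (_ : _ + _ = \sum_j \sum_i (J i j * (('D_v f x) 0 i * g x 0 j + f x 0 i * ('D_v g x) 0 j))).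
  apply: is_derive_bigsum => j _; apply: is_derive_bigsum => i _.
  apply: is_derive_eq.
    apply: (@is_deriveM _ _ (cst (J i j)) (fun y => f y 0 i * g y 0 j) x v 0 _ (is_derive_cst _ _ _)).
    by apply: is_deriveM; exact: is_derive_entry.
  rewrite /GRing.scale /= mulr0 addr0.
  by move: (f x 0 i) (g x 0 j) (('D_v f x) 0 i) (('D_v g x) 0 j) => a b c d; ring.
rewrite /bform !mxE -big_split /=; apply: eq_bigr => j _.
rewrite !mxE !mulr_suml -big_split /=; apply: eq_bigr => i _.
by move: (f x 0 i) (g x 0 j) (('D_v f x) 0 i) (('D_v g x) 0 j) => a b c d; ring.
Qed.

Lemma derive_comm_mx p q (F : V -> 'M[R]_(p, q)) x u v : (\near x, differentiable F x) ->
  differentiable ('D_u F) x -> differentiable ('D_v F) x ->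
  'D_u ('D_v F) x = 'D_v ('D_u F) x.
Proof.
move=> dF dDu dDv.
have entryE w i j : \near x, is_derive x w (fun y => F y i j) (('D_w F x) i j).
  by near=> y; apply: is_derive_entry; apply: diff_derivable; near: y.
rewrite (derive_mx (diff_derivable (v := u) dDv)) (derive_mx (diff_derivable (v := v) dDu)).
apply/matrixP => i j; rewrite [LHS]mxE [RHS]mxE.
by apply: young (entryE u i j) (entryE v i j) _ _; exact: differentiable_entries.
Unshelve. all: by end_near.
Qed.

End MatrixValued.

Section Rn.
Variables (R : realType) (n : nat).

Lemma derive0_ball_cst (f : 'rV[R]_n -> R) x r : 0 < r ->
  (forall y, ball x r y -> differentiable f y) ->
  (forall y i, ball x r y -> 'D_(basis_vec R i) f y = 0) ->
  forall y, ball x r y -> f y = f x.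
Proof.
move=> r0 df f0 y xy.
pose v := y - x; have vr : `|v| < r by move: xy; rewrite -ball_normE /ball_ /= distrC.
have seg t : 0 <= t <= 1 -> ball x r (x + t *: v).
  move=> /andP[t0 t1]; rewrite -ball_normE /ball_ /= opprD addrA subrr add0r normrN normrZ.
  by rewrite (ger0_norm t0) (le_lt_trans _ vr) // ler_piMl.
have dline (t : R) : 0 <= t <= 1 -> is_derive t 1 (fun s : R => f (x + s *: v)) 0.
  move=> /seg bt; apply: is_derive_eq; first by apply: is_derive_line; exact/derivableP/diff_derivable/df.
  rewrite (deriveE _ (df _ bt)) [X in 'd _ _ X]row_sum_delta linear_sum.
  apply: big1 => i _; rewrite linearZ /= -(deriveE _ (df _ bt)) -/(basis_vec R i).
  by rewrite f0 // scaler0.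
have [||t _] := @MVT_segment R (fun s : R => f (x + s *: v)) (cst 0) 0 1 ler01.
- by move=> t; rewrite in_itv /= => /andP[? ?]; apply: dline; rewrite !ltW.
- apply: derivable_within_continuous => t; rewrite in_itv /= => th.
  by have [] := dline t th.
by rewrite mul0r scale1r scale0r addr0 /v (addrC x) subrK => /eqP; rewrite subr_eq0 => /eqP.
Qed.
End Rn.

(* Locked because conversion between distinct iterated derivatives would unfold
   the underlying limits. *)
HB.lock Definition jet (R : realType) (n N : nat) (F : 'rV[R]_n -> 'rV[R]_N)
    (s : seq 'I_n) : 'rV[R]_n -> 'rV[R]_N :=
  foldr (@partial R n 'rV[R]_N) F s.

(** * Iterated partial derivatives and their scalar products *)

Section Jets.
Variables (R : realType) (n N : nat).
Implicit Types (F H : 'rV[R]_n -> 'rV[R]_N) (s t : seq 'I_n) (J : 'M[R]_N).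

Lemma jet_nil F : jet F [::] = F. Proof. by rewrite jet.unlock. Qed.

Lemma jet_cons F i s : jet F (i :: s) = 'D_(basis_vec R i) (jet F s).
Proof. by rewrite jet.unlock. Qed.

Variable U : set 'rV[R]_n.
Hypothesis openU : open U.

Lemma near_open (P : 'rV[R]_n -> Prop) x : U x -> (forall y, U y -> P y) -> \near x, P x.
Proof. by move=> Ux UP; apply: filterS UP _; exact: open_nbhs_nbhs. Qed.

Lemma jet_differentiable F s x : smooth_on U F -> U x -> differentiable (jet F s) x.
Proof. by move=> sF Ux; rewrite jet.unlock; exact: sF. Qed.

Lemma jet_derivable F s x v : smooth_on U F -> U x -> derivable (jet F s) x v.
Proof. by move=> sF Ux; exact/diff_derivable/jet_differentiable. Qed.

Lemma jet_swap F i j s x : smooth_on U F -> U x ->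
  jet F (i :: j :: s) x = jet F (j :: i :: s) x.
Proof.
move=> sF Ux; rewrite !jet_cons; apply: derive_comm_mx.
- by apply: near_open Ux _ => y Uy; exact: jet_differentiable.
- by rewrite -jet_cons; exact: jet_differentiable.
- by rewrite -jet_cons; exact: jet_differentiable.
Qed.

Lemma eq_jet_cons F H i s t x : U x -> (forall y, U y -> jet F s y = jet H t y) ->
  jet F (i :: s) x = jet H (i :: t) x.
Proof. by move=> Ux e; rewrite !jet_cons; apply: near_eq_derive; exact: near_open Ux e. Qed.

Lemma jet_swap2 F i j k x : smooth_on U F -> U x ->
  jet F [:: i; j; k] x = jet F [:: j; k; i] x.
Proof.
move=> sF Ux; rewrite jet_swap //.
by apply: eq_jet_cons Ux _ => y Uy; exact: jet_swap.
Qed.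

Lemma is_derive_jet_form J F s t i x : smooth_on U F -> U x ->
  is_derive x (basis_vec R i) (fun y => bform J (jet F s y) (jet F t y))
    (bform J (jet F (i :: s) x) (jet F t x) + bform J (jet F s x) (jet F (i :: t) x)).
Proof. by move=> sF Ux; rewrite !jet_cons; apply: derive_bform; exact: jet_derivable. Qed.

Lemma jet_form_cst J F s t c i x : smooth_on U F -> U x ->
  (forall y, U y -> bform J (jet F s y) (jet F t y) = c) ->
  bform J (jet F (i :: s) x) (jet F t x) + bform J (jet F s x) (jet F (i :: t) x) = 0.
Proof.
move=> sF Ux e; have [_ <-] := is_derive_jet_form J s t i sF Ux.
rewrite -[RHS](derive_cst c x (basis_vec R i)); apply: near_eq_derive.
exact: near_open Ux e.
Qed.

Lemma jet_form_eq J F H s t i x : smooth_on U F -> smooth_on U H -> U x ->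
  (forall y, U y -> bform J (jet F s y) (jet F t y) = bform J (jet H s y) (jet H t y)) ->
  bform J (jet F (i :: s) x) (jet F t x) + bform J (jet F s x) (jet F (i :: t) x) =
  bform J (jet H (i :: s) x) (jet H t x) + bform J (jet H s x) (jet H (i :: t) x).
Proof.
move=> sF sH Ux e; have [_ <-] := is_derive_jet_form J s t i sF Ux.
have [_ <-] := is_derive_jet_form J s t i sH Ux.
by apply: near_eq_derive; exact: near_open Ux e.
Qed.

Section Isometric.
Variables (J : 'M[R]_N) (F H : 'rV[R]_n -> 'rV[R]_N).
Hypotheses (symJ : J^T = J) (sF : smooth_on U F) (sH : smooth_on U H).
Hypothesis eq00 : forall x, U x -> bform J (jet F [::] x) (jet F [::] x) = bform J (jet H [::] x) (jet H [::] x).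
Hypothesis eq11 : forall i j x, U x ->
  bform J (jet F [:: i] x) (jet F [:: j] x) = bform J (jet H [:: i] x) (jet H [:: j] x).

Lemma eq10 i x : U x -> bform J (jet F [:: i] x) (jet F [::] x) = bform J (jet H [:: i] x) (jet H [::] x).
Proof.
move=> Ux; have := jet_form_eq (s := [::]) (t := [::]) (J := J) i sF sH Ux eq00.
by rewrite !(bformC (jet _ [::] x)) //; lra.
Qed.

Lemma eq20 i j x : U x ->
  bform J (jet F [:: i; j] x) (jet F [::] x) = bform J (jet H [:: i; j] x) (jet H [::] x).
Proof.
move=> Ux; have := jet_form_eq (s := [:: j]) (t := [::]) (J := J) i sF sH Ux (@eq10 j).
by have := eq11 j i Ux; lra.
Qed.

(** The Koszul formula: three derivatives of the metric, with indices permuted, determine the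
    Christoffel symbols of the first kind. *)
Lemma eq21 i j k x : U x -> bform J (jet F [:: i; j] x) (jet F [:: k] x) =
  bform J (jet H [:: i; j] x) (jet H [:: k] x).
Proof.
move=> Ux.
have := jet_form_eq (J := J) i sF sH Ux (@eq11 j k).
have := jet_form_eq (J := J) j sF sH Ux (@eq11 i k).
have := jet_form_eq (J := J) k sF sH Ux (@eq11 i j).
rewrite !(jet_swap j i) // !(jet_swap k i) // !(jet_swap k j) //.
rewrite !(bformC (jet _ [:: i] x) (jet _ [:: _; _] x)) // !(bformC (jet _ [:: j] x) (jet _ [:: _; _] x)) //.
move: (bform _ _ _) (bform _ _ _) (bform _ _ _) (bform _ _ _) (bform _ _ _) (bform _ _ _).
move=> a b c d e f; lra.
Qed.

(** Differentiating [eq21] in two ways yields the same third derivative, which cancels. This is the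
    Gauss equation, with equality of the intrinsic curvatures built in. *)
Lemma gauss i j k l x : U x ->
  bform J (jet F [:: i; k] x) (jet F [:: j; l] x) -
  bform J (jet F [:: i; j] x) (jet F [:: k; l] x) =
  bform J (jet H [:: i; k] x) (jet H [:: j; l] x) -
  bform J (jet H [:: i; j] x) (jet H [:: k; l] x).
Proof.
move=> Ux.
have := jet_form_eq (J := J) j sF sH Ux (@eq21 i k l).
have := jet_form_eq (J := J) k sF sH Ux (@eq21 i j l).
have e (P : 'rV[R]_n -> 'rV[R]_N) : smooth_on U P -> jet P [:: k; i; j] x = jet P [:: j; i; k] x.
  by move=> sP; rewrite (jet_swap2 k i j sP Ux) (jet_swap i j [:: k] sP Ux).
rewrite (e F sF) (e H sH).
move: (bform _ _ _) (bform _ _ _) (bform _ _ _) (bform _ _ _) (bform _ _ _) (bform _ _ _).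
move=> a b c d f g; lra.
Qed.
End Isometric.
End Jets.

(** * Frames adapted to a hypersurface *)

Section Forms.
Variables (R : realType) (k m : nat).
Notation N := (k.+1 + m.+1)%N.
Implicit Types (u v w z : 'rV[R]_N).

Definition lform1 : 'M[R]_N :=
  block_mx (diag_mx (\row_j (if j == ord0 then -1 else 1))) 0 0 0.
Definition lform2 : 'M[R]_N := block_mx 0 0 0 1%:M.
Definition lform : 'M[R]_N := lform1 + lform2.

Lemma lform1E u v : bform lform1 u v = lorentz (lsubmx u) (lsubmx v).
Proof.
rewrite -{1}(hsubmxK u) -{1}(hsubmxK v) /bform mul_row_block !mulmx0 !addr0.
rewrite tr_row_mx mul_row_col mul0mx addr0 mxE big_ord_recl /lorentz.
rewrite mul_mx_diag !mxE eqxx mulrN1 mulNr; congr (_ + _).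
by apply: eq_bigr => i _; rewrite !mxE mulr1.
Qed.

Lemma lform2E u v : bform lform2 u v = euclid (rsubmx u) (rsubmx v).
Proof.
rewrite -{1}(hsubmxK u) -{1}(hsubmxK v) /bform mul_row_block !mulmx0 !addr0 add0r mulmx1.
rewrite tr_row_mx mul_row_col mul0mx add0r mxE /euclid.
by apply: eq_bigr => i _; rewrite !mxE.
Qed.

Lemma lformE u v : bform lform u v = ldot u v.
Proof. by rewrite bform_addm lform1E lform2E. Qed.

Lemma lform1_sym : lform1^T = lform1.
Proof. by rewrite /lform1 tr_block_mx tr_diag_mx !trmx0. Qed.

Lemma lform2_sym : lform2^T = lform2.
Proof. by rewrite /lform2 tr_block_mx trmx1 !trmx0. Qed.

Lemma lform_sym : lform^T = lform.
Proof. by rewrite linearD /= lform1_sym lform2_sym. Qed.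

Lemma lform_sqr : lform *m lform = 1%:M.
Proof.
rewrite /lform /lform1 /lform2 add_block_mx !(addr0, add0r) mulmx_block.
rewrite !(mulmx0, mul0mx) !(addr0, add0r) mulmx1 mulmx_diag [RHS]scalar_mx_block.
congr (block_mx _ _ _ _); apply/matrixP => i j; rewrite !mxE.
congr (_ *+ _); by case: eqP => _; rewrite ?mulrNN ?mulr1.
Qed.

Lemma lform_unit : lform \in unitmx.
Proof. by case: (mulmx1_unit lform_sqr). Qed.

Definition part1 z : 'rV[R]_N := row_mx (lsubmx z) 0.
Definition part2 z : 'rV[R]_N := row_mx 0 (rsubmx z).

Lemma lform_part1 u z : bform lform u (part1 z) = bform lform1 u z.
Proof.
rewrite lformE /ldot lform1E row_mxKl row_mxKr /euclid big1 ?addr0 // => i _.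
by rewrite [X in _ * X]mxE mulr0.
Qed.

Lemma lform_part2 u z : bform lform u (part2 z) = bform lform2 u z.
Proof.
rewrite lformE /ldot lform2E row_mxKl row_mxKr /lorentz big1 ?addr0 1?[X in - (_ * X)]mxE ?mulr0 ?oppr0 ?add0r // => i _.
by rewrite [X in _ * X]mxE mulr0.
Qed.

Lemma lform1_part1 u z : bform lform1 u (part1 z) = bform lform1 u z.
Proof. by rewrite !lform1E row_mxKl. Qed.

Lemma lform1_part2 u z : bform lform1 u (part2 z) = 0.
Proof.
rewrite lform1E row_mxKl /lorentz big1 ?addr0 1?[X in - (_ * X)]mxE ?mulr0 ?oppr0 // => i _.
by rewrite [X in _ * X]mxE mulr0.
Qed.

Lemma lform2_part1 u z : bform lform2 u (part1 z) = 0.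
Proof. by rewrite lform2E row_mxKr /euclid big1 // => i _; rewrite [X in _ * X]mxE mulr0. Qed.

Lemma lform2_part2 u z : bform lform2 u (part2 z) = bform lform2 u z.
Proof. by rewrite !lform2E row_mxKr. Qed.

Lemma lform2_ge0 u : 0 <= bform lform2 u u.
Proof. by rewrite lform2E; apply: sumr_ge0 => i _; rewrite -expr2 sqr_ge0. Qed.

(* [x_0 ^+ 2 <w, w> = |x_0 w' - w_0 x'| ^+ 2 + w_0 ^+ 2] for the space parts
   [x'] and [w'], when [<x, x> = -1] and [<x, w> = 0]. *)
Lemma lorentz_orthogonal (x w : 'rV[R]_k.+1) : lorentz x x = -1 -> lorentz x w = 0 ->
  0 <= lorentz w w /\ (lorentz w w = 0 -> w = 0).
Proof.
rewrite /lorentz; set x0 := x 0 ord0; set w0 := w 0 ord0.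
set xx := \sum_(i < k) _; set xw := \sum_(i < k) _; set ww := \sum_(i < k) _ => e1 e2.
have key : x0 ^+ 2 * (- (w0 * w0) + ww) =
    \sum_(i < k) (x0 * w 0 (lift ord0 i) - w0 * x 0 (lift ord0 i)) ^+ 2 + w0 ^+ 2.
  have -> : \sum_(i < k) (x0 * w 0 (lift ord0 i) - w0 * x 0 (lift ord0 i)) ^+ 2 =
      x0 ^+ 2 * ww - 2 * x0 * w0 * xw + w0 ^+ 2 * xx.
    rewrite /ww /xw /xx !mulr_sumr -sumrB -big_split /=.
    by apply: eq_bigr => i _; ring.
  have -> : xw = x0 * w0 by lra.
  have -> : xx = x0 * x0 - 1 by lra.
  by ring.
have sq0 : 0 <= \sum_(i < k) (x0 * w 0 (lift ord0 i) - w0 * x 0 (lift ord0 i)) ^+ 2.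
  by apply: sumr_ge0 => i _; exact: sqr_ge0.
have xx0 : 0 <= xx by apply: sumr_ge0 => i _; rewrite -expr2 sqr_ge0.
have x2 : 0 < x0 ^+ 2 by rewrite expr2; lra.
split=> [|w00].
  by rewrite -(pmulr_rge0 _ x2) key addr_ge0 // sqr_ge0.
move: key; rewrite w00 mulr0 => /esym/eqP.
rewrite paddr_eq0 ?sqr_ge0 // => /andP[_]; rewrite sqrf_eq0 => /eqP w0E.
have ww0 : ww = 0 by move: w00; rewrite w0E; lra.
apply/rowP => i; rewrite mxE; case: (unliftP ord0 i) => [j ->|->]; last exact: w0E.
move/eqP: ww0; rewrite psumr_eq0 => [/allP/(_ j)|i' _]; last by rewrite -expr2 sqr_ge0.
by rewrite mem_index_enum => /(_ isT); rewrite -expr2 sqrf_eq0 => /eqP.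
Qed.

(** The hyperbolic component of [z] is timelike, and the complement of a timelike vector is positive
    definite. *)
Lemma lform_spacelike z w : bform lform1 z z = -1 -> bform lform1 z w = 0 -> w != 0 ->
  0 < bform lform w w.
Proof.
rewrite !lform1E => zz zw w0; have [ge0 eq0] := lorentz_orthogonal zz zw.
have := lform2_ge0 w; rewrite bform_addm lform1E => ge0'.
rewrite lt_neqAle addr_ge0 // andbT eq_sym paddr_eq0 //.
apply: contra w0 => /andP[/eqP/eq0 wl /eqP]; rewrite lform2E => wr.
rewrite -(hsubmxK w) wl; suff -> : rsubmx w = 0 by rewrite row_mx0.
apply/rowP => i; rewrite [RHS]mxE.
move/eqP: wr; rewrite psumr_eq0 => [/allP/(_ i)|i' _]; last by rewrite -expr2 sqr_ge0.
by rewrite mem_index_enum => /(_ isT); rewrite -expr2 sqrf_eq0 => /eqP.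
Qed.
End Forms.

(** A right inverse of the square matrix [E] is a left inverse. The shape is kept as [p] by [N] with
    an equation, since frames arise as stacked blocks of height [n + 3]. *)
Lemma frame_inverse (R : comUnitRingType) (p N : nat) (E : 'M[R]_(p, N)) (J : 'M[R]_N)
    (C : 'M[R]_p) : p = N -> E *m J *m E^T *m C = 1%:M -> J *m E^T *m C *m E *m J = J.
Proof.
move=> pN; move: E J; case: N / pN => E J; rewrite -!mulmxA => /mulmx1C.
by rewrite !mulmxA => e; rewrite e mul1mx.
Qed.

Section Frame.
Variables (R : realType) (n k m : nat).
Notation N := (k.+1 + m.+1)%N.
Notation J := (lform R k m).
Notation J1 := (lform1 R k m).
Notation J2 := (lform2 R k m).
Hypothesis dimN : (n + 3)%N = N.
Variables (z : 'rV[R]_N) (e : 'M[R]_(n, N)).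
Hypotheses (z1 : bform J1 z z = -1) (z2 : bform J2 z z = 1).
Hypotheses (e1 : forall i, bform J1 (row i e) z = 0) (e2 : forall i, bform J2 (row i e) z = 0).

Lemma lform_normalize (w : 'rV[R]_N) : 0 < bform J w w ->
  bform J ((Num.sqrt (bform J w w))^-1 *: w) ((Num.sqrt (bform J w w))^-1 *: w) = 1.
Proof.
move=> w0; rewrite bformZl bformZr mulrA -invfM -expr2 sqr_sqrtr; last exact: ltW.
by rewrite mulVf //; apply: lt0r_neq0.
Qed.

(** There are n + 2 linear conditions in dimension n + 3, and a nonzero solution is spacelike, hence
    can be normalized. *)
Lemma normal_exists : exists xi : 'rV[R]_N, [/\ bform J xi xi = 1,
  forall i, bform J (row i e) xi = 0, bform J1 z xi = 0 & bform J2 z xi = 0].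
Proof.
pose s := [seq row i e *m J | i <- enum 'I_n] ++ [:: z *m J1; z *m J2].
have [|w w0 ow] := @common_orthogonal _ _ s.
  by rewrite size_cat size_map size_enum_ord /=; lia.
have we i : bform J (row i e) w = 0.
  by rewrite bform_mul ow // mem_cat; apply/orP; left; apply/mapP; exists i; rewrite ?mem_enum.
have wz1 : bform J1 z w = 0 by rewrite bform_mul ow // mem_cat !inE eqxx !orbT.
have wz2 : bform J2 z w = 0 by rewrite bform_mul ow // mem_cat !inE eqxx !orbT.
have ww := lform_spacelike z1 wz1 w0.
exists ((Num.sqrt (bform J w w))^-1 *: w); split; first exact: lform_normalize.
- by move=> i; rewrite bformZr we mulr0.
- by rewrite bformZr wz1 mulr0.
- by rewrite bformZr wz2 mulr0.
Qed.

Variable G : 'M[R]_n.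
Hypothesis eG : e *m J *m e^T = G.
Hypothesis unitG : G \in unitmx.

Variable xi : 'rV[R]_N.
Hypotheses (xi_unit : bform J xi xi = 1) (xi_e : forall i, bform J (row i e) xi = 0).
Hypotheses (xi_z1 : bform J1 z xi = 0) (xi_z2 : bform J2 z xi = 0).

Definition tcoord (u : 'rV[R]_N) : 'rV[R]_n := u *m J *m e^T.

Lemma tcoordE u i : tcoord u 0 i = bform J u (row i e).
Proof. by rewrite /bform tr_row colE mulmxA -colE [RHS]mxE. Qed.

Lemma tcoord_trmx (u : 'rV[R]_N) : u *m J *m e^T = (e *m J *m u^T)^T.
Proof. by rewrite !trmx_mul trmxK lform_sym mulmxA. Qed.

Lemma mul_bform (u v : 'rV[R]_N) : u *m J *m v^T = (bform J u v)%:M.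
Proof. exact: mx11_scalar. Qed.

(** The rows of [e], [xi] and the two components of [z] form a basis whose Gram matrix has the
    blocks [G], 1, -1, 1; the formula reads the scalar product off the inverse of that matrix. *)
Lemma frame_expansion u v : bform J u v =
  bform (invmx G) (tcoord u) (tcoord v) + bform J u xi * bform J v xi
  - bform J1 u z * bform J1 v z + bform J2 u z * bform J2 v z.
Proof.
pose b := col_mx xi (col_mx (part1 z) (part2 z)).
pose E := col_mx e b.
pose D : 'M[R]_(1 + (1 + 1)) := block_mx (1%:M : 'M[R]_1) 0 0 (block_mx ((-1)%:M : 'M[R]_1) 0 0 (1%:M : 'M[R]_1)).
pose C := block_mx (invmx G) 0 0 D.
have symJ := lform_sym R k m.
have sym1 := lform1_sym R k m.
have sym2 := lform2_sym R k m.
have eb w : (forall i, bform J (row i e) w = 0) -> e *m J *m w^T = 0.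
  by move=> h; apply/colP => i; rewrite [RHS]mxE -(h i) /bform -!row_mul [RHS]mxE.
have be w : (forall i, bform J (row i e) w = 0) -> w *m J *m e^T = 0.
  by move=> /eb h; rewrite tcoord_trmx h trmx0.
have ep1 i : bform J (row i e) (part1 z) = 0 by rewrite lform_part1 e1.
have ep2 i : bform J (row i e) (part2 z) = 0 by rewrite lform_part2 e2.
have EJE : E *m J *m E^T = block_mx G 0 0 D.
  rewrite /E mul_col_mx tr_col_mx mul_col_row eG; congr (block_mx _ _ _ _).
  - by rewrite /b !tr_col_mx !mul_mx_row !eb // !row_mx0.
  - by rewrite /b !mul_col_mx !be // !col_mx0.
  have zx1 : bform J1 xi z = 0 by rewrite (bformC _ _ sym1).
  have zx2 : bform J2 xi z = 0 by rewrite (bformC _ _ sym2).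
  have p12 : bform J1 (part2 z) z = 0 by rewrite (bformC _ _ sym1) lform1_part2.
  have p11 : bform J1 (part1 z) z = -1 by rewrite (bformC _ _ sym1) lform1_part1.
  have p21 : bform J2 (part1 z) z = 0 by rewrite (bformC _ _ sym2) lform2_part1.
  have p22 : bform J2 (part2 z) z = 1 by rewrite (bformC _ _ sym2) lform2_part2.
  have s0 : (0 : R)%:M = 0 :> 'M[R]_1 by exact: raddf0.
  rewrite /b mul_col_mx [X in _ *m X]tr_col_mx mul_col_row; congr (block_mx _ _ _ _).
  - by rewrite mul_bform xi_unit.
  - rewrite tr_col_mx mul_mx_row !mul_bform lform_part1 lform_part2 zx1 zx2.
    by rewrite s0 row_mx0.
  - rewrite !mul_col_mx !mul_bform !(bformC _ xi) // lform_part1 lform_part2 zx1 zx2.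
    by rewrite s0 col_mx0.
  rewrite mul_col_mx tr_col_mx mul_col_row !mul_bform !lform_part1 !lform_part2.
  by rewrite p11 p12 p21 p22 s0.
have D2 : D *m D = 1%:M.
  rewrite /D mulmx_block !(mulmx0, mul0mx, addr0, add0r) mulmx_block.
  rewrite !(mulmx0, mul0mx, addr0, add0r) -!scalar_mxM mulN1r opprK mulr1.
  by rewrite -!scalar_mx_block.
have C1 : E *m J *m E^T *m C = 1%:M.
  rewrite EJE /C mulmx_block !(mulmx0, mul0mx, addr0, add0r) mulmxV // D2.
  by rewrite -scalar_mx_block.
have := frame_inverse dimN C1 => JE.
have Jv w : E *m J *m w^T = (w *m J *m E^T)^T.
  by rewrite !trmx_mul trmxK symJ mulmxA.
have wE w : w *m J *m E^T = row_mx (tcoord w)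
    (row_mx (bform J w xi)%:M (row_mx (bform J1 w z)%:M (bform J2 w z)%:M)).
  by rewrite /E /b !tr_col_mx !mul_mx_row !mul_bform lform_part1 lform_part2.
have -> : bform J u v = ((u *m J *m E^T) *m C *m (v *m J *m E^T)^T) 0 0.
  by rewrite -Jv /bform -{1}JE !mulmxA.
rewrite !wE /C mul_row_block !(mulmx0, mul0mx, addr0, add0r).
rewrite /D !mul_row_block !(mulmx0, mul0mx, addr0, add0r).
rewrite !tr_row_mx !mul_row_col mulmx1 !mul_mx_scalar !tr_scalar_mx scaleN1r scale1r mulNmx.
rewrite -!scalar_mxM.
have add_scalar (P : 'M[R]_1) c : (P + c%:M) 0 0 = P 0 0 + c by rewrite !mxE eqxx mulr1n.
by rewrite -raddfN /= -!raddfD /= add_scalar /bform !addrA.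
Qed.

Lemma lform_nondegenerate (w : 'rV[R]_N) : (forall v, bform J w v = 0) -> w = 0.
Proof.
move=> h; rewrite -[w]mulmx1 -(lform_sqr R k m) mulmxA.
suff -> : w *m J = 0 by rewrite mul0mx.
by apply: bform_row0 => v; rewrite -bform_mul.
Qed.

Lemma tangent_bform (P : 'M[R]_N) c v :
  bform P (c *m e) v = (c *m (e *m P *m v^T)) 0 0.
Proof. by rewrite /bform !mulmxA. Qed.

(** The basis uses [z] itself in place of [part1 z], because the forms to be expanded later vanish
    on [z]. *)
Lemma vector_expansion u : u = tcoord u *m invmx G *m e + bform J u xi *: xi
  - bform J1 u z *: z + bform J u z *: part2 z.
Proof.
apply/eqP; rewrite -subr_eq0; apply/eqP/lform_nondegenerate => v.
rewrite bformDl bformNl !bformDl bformNl !bformZl tangent_bform frame_expansion.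
have -> : (tcoord u *m invmx G *m (e *m J *m v^T)) 0 0 = bform (invmx G) (tcoord u) (tcoord v).
  by rewrite /bform /tcoord (tcoord_trmx v) trmxK.
rewrite !(bformC _ v) ?lform_sym // lform_part2.
by rewrite [bform J u z]bform_addm [bform J v z]bform_addm; ring.
Qed.

(** Such a form descends to the plane spanned by the classes of [xi] and [part2 z], where a skew
    form is determined by one number. *)
Lemma skew_form_normal (P : 'M[R]_N) : P^T = - P -> z *m P = 0 -> e *m P = 0 -> forall u v,
  bform P u v = (bform J u xi * bform J v z - bform J u z * bform J v xi) *
    bform P xi (part2 z).
Proof.
move=> skP zP eP u v.
have skew a b : bform P a b = - bform P b a.
  rewrite -bform_oppm -skP /bform -[in LHS](trmxK (a *m P *m _)) [in LHS]mxE.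
  by rewrite !trmx_mul trmxK mulmxA.
have zl a : bform P z a = 0 by rewrite /bform zP mul0mx mxE.
have zr a : bform P a z = 0 by rewrite skew zl oppr0.
have el c a : bform P (c *m e) a = 0 by rewrite tangent_bform eP !mul0mx mulmx0 mxE.
have er c a : bform P a (c *m e) = 0 by rewrite skew el oppr0.
have diag a : bform P a a = 0 by have := skew a a; lra.
rewrite [in LHS](vector_expansion u) [in LHS](vector_expansion v).
rewrite !(bformDl, bformDr, bformNl, bformNr, bformZl, bformZr) !el !er !zl !zr !diag.
by rewrite (skew (part2 z) xi); ring.
Qed.

(* The vectors [z], [e_i] and [h_jk] play the roles of the position vector and
   its first and second derivatives. *)
Lemma second_order_span (h : 'I_n -> 'I_n -> 'rV[R]_N) :
  (forall i j, bform J (h i j) z = - G i j) -> G != 0 ->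
  (forall l, \matrix_(i, j) bform J (h i j) xi <> l *: G) ->
  forall w, bform J w z = 0 -> (forall i, bform J w (row i e) = 0) ->
  (forall i j, bform J w (h i j) = 0) -> w = 0.
Proof.
move=> hz G0 nA w wz we wh.
have tw : tcoord w = 0 by apply/rowP => i; rewrite tcoordE we mxE.
have wE v : bform J w v = bform J w xi * bform J v xi - bform J1 w z * bform J v z.
  have := wz; rewrite bform_addm => wz'; have w2 : bform J2 w z = - bform J1 w z by lra.
  by rewrite frame_expansion tw bform0l w2 [bform J v z]bform_addm; ring.
have rel i j : bform J w xi * bform J (h i j) xi + bform J1 w z * G i j = 0.
  by have := wE (h i j); rewrite wh hz; lra.
have a0 : bform J w xi = 0.
  apply: contrapT => /eqP a0; apply: (nA (- bform J1 w z / bform J w xi)).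
  apply/matrixP => i j; rewrite !mxE; apply: (mulfI a0).
  have -> : bform J w xi * (- bform J1 w z / bform J w xi * G i j) = - bform J1 w z * G i j.
    by move: a0; move: (bform J w xi) => a a0; field.
  by have := rel i j; lra.
have [i [j Gij]] : exists i j, G i j != 0.
  apply: contrapT => h0; move/eqP: G0; apply; apply/matrixP => i j; rewrite mxE.
  by apply/eqP; apply: contraT => Gij; case: h0; exists i, j.
have b0 : bform J1 w z = 0.
  by have := rel i j; rewrite a0 mul0r add0r => /eqP; rewrite mulf_eq0 (negPf Gij) orbF => /eqP.
by apply: lform_nondegenerate => v; rewrite wE a0 b0; ring.
Qed.
End Frame.

(** * Local rigidity *)

Lemma linear_vanish (R : realType) n (phi : 'rV[R]_n -> R) :
  (forall a u v, phi (a *: u + v) = a * phi u + phi v) ->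
  (forall i, phi (delta_mx 0 i) = 0) -> forall u, phi u = 0.
Proof.
move=> lin phi0 u; have phi00 : phi 0 = 0.
  by have := lin 1 0 0; rewrite scaler0 addr0 mul1r; lra.
rewrite (row_sum_delta u); elim/big_rec: _ => // i v _ IH.
by rewrite lin phi0 IH mulr0 addr0.
Qed.

(** * The 2-jet of one map into the product *)

Section OneMap.
Variables (R : realType) (n k m : nat).
Notation N := (k.+1 + m.+1)%N.
Notation J := (lform R k m).
Notation J1 := (lform1 R k m).
Notation J2 := (lform2 R k m).
Variables (U : set 'rV[R]_n) (F : 'rV[R]_n -> 'rV[R]_N).
Hypotheses (openU : open U) (sF : smooth_on U F).
Hypotheses (F1 : forall x, U x -> bform J1 (F x) (F x) = -1)
  (F2 : forall x, U x -> bform J2 (F x) (F x) = 1).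

Definition jac x : 'M[R]_(n, N) := \matrix_i jet F [:: i] x.
Definition metric x : 'M[R]_n := jac x *m J *m (jac x)^T.
Definition second_form x xi : 'M[R]_n := \matrix_(i, j) bform J (jet F [:: i; j] x) xi.

Lemma row_jac x i : row i (jac x) = jet F [:: i] x.
Proof. exact: rowK. Qed.

Lemma metricE x i j : metric x i j = bform J (jet F [:: i] x) (jet F [:: j] x).
Proof. by rewrite -!row_jac -tcoordE /tcoord -!row_mul [RHS]mxE. Qed.

Lemma metric_sym x : (metric x)^T = metric x.
Proof. by rewrite /metric !trmx_mul trmxK lform_sym mulmxA. Qed.

Lemma second_form_sym x xi : U x -> (second_form x xi)^T = second_form x xi.
Proof.
by move=> Ux; apply/matrixP => i j; rewrite !mxE (jet_swap openU j i [::] sF Ux).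
Qed.

Lemma jet1_J1 i x : U x -> bform J1 (jet F [:: i] x) (F x) = 0.
Proof.
move=> Ux; have := jet_form_cst (J := J1) (F := F) (s := [::]) (t := [::]) openU (c := -1) i sF Ux.
rewrite !jet_nil => /(_ F1); rewrite (bformC (F x)) ?lform1_sym //; lra.
Qed.

Lemma jet1_J2 i x : U x -> bform J2 (jet F [:: i] x) (F x) = 0.
Proof.
move=> Ux; have := jet_form_cst (J := J2) (F := F) (s := [::]) (t := [::]) openU (c := 1) i sF Ux.
rewrite !jet_nil => /(_ F2); rewrite (bformC (F x)) ?lform2_sym //; lra.
Qed.

Lemma jet2_J1 i j x : U x -> bform J1 (jet F [:: i; j] x) (F x) =
  - bform J1 (jet F [:: i] x) (jet F [:: j] x).
Proof.
move=> Ux; have := jet_form_cst (J := J1) (F := F) (s := [:: j]) (t := [::]) openU (c := 0) i sF Ux.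
rewrite !jet_nil => /(_ (@jet1_J1 j)).
by rewrite (bformC (jet F [:: i] x)) ?lform1_sym //; lra.
Qed.

Lemma jet2_J2 i j x : U x -> bform J2 (jet F [:: i; j] x) (F x) =
  - bform J2 (jet F [:: i] x) (jet F [:: j] x).
Proof.
move=> Ux; have := jet_form_cst (J := J2) (F := F) (s := [:: j]) (t := [::]) openU (c := 0) i sF Ux.
rewrite !jet_nil => /(_ (@jet1_J2 j)).
by rewrite (bformC (jet F [:: i] x)) ?lform2_sym //; lra.
Qed.

Lemma jet2_J i j x : U x -> bform J (jet F [:: i; j] x) (F x) = - metric x i j.
Proof.
by move=> Ux; rewrite metricE [LHS]bform_addm [in RHS]bform_addm jet2_J1 // jet2_J2 //; ring.
Qed.

Definition unit_normal_jet x xi := [/\ bform J xi xi = 1,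
  forall i, bform J (jet F [:: i] x) xi = 0, bform J1 (F x) xi = 0 & bform J2 (F x) xi = 0].

Hypothesis dimN : (n + 3)%N = N.

Lemma unit_normal_jet_exists x : U x -> exists xi, unit_normal_jet x xi.
Proof.
move=> Ux; have [xi [a b c d]] := @normal_exists R n k m dimN (F x) (jac x) (F1 Ux).
exists xi; split=> // i; by rewrite -row_jac.
Qed.

Hypothesis metric_unit : forall x, U x -> metric x \in unitmx.

(** The frame expansion of second derivatives. The components along the two factors of the position
    vector are first fundamental forms of the factors, by differentiating [F1] and [F2] twice. *)
Lemma jet2_product x xi i j p q : U x -> unit_normal_jet x xi ->
  bform J (jet F [:: i; j] x) (jet F [:: p; q] x) =
  bform (invmx (metric x)) (\row_l bform J (jet F [:: i; j] x) (jet F [:: l] x))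
    (\row_l bform J (jet F [:: p; q] x) (jet F [:: l] x))
  + second_form x xi i j * second_form x xi p q
  - bform J1 (jet F [:: i] x) (jet F [:: j] x) * bform J1 (jet F [:: p] x) (jet F [:: q] x)
  + bform J2 (jet F [:: i] x) (jet F [:: j] x) * bform J2 (jet F [:: p] x) (jet F [:: q] x).
Proof.
move=> Ux [x1 x2 x3 x4].
rewrite (@frame_expansion R n k m dimN (F x) (jac x) (F1 Ux) (F2 Ux) _ _ (metric x) _ _ xi) //.
- rewrite !jet2_J1 // !jet2_J2 // !mulrNN ![second_form _ _ _ _]mxE.
  have tE s : tcoord (jac x) (jet F s x) = \row_l bform J (jet F s x) (jet F [:: l] x).
    by apply/rowP => l; rewrite tcoordE row_jac mxE.
  by rewrite !tE.
- by move=> l; rewrite row_jac jet1_J1.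
- by move=> l; rewrite row_jac jet1_J2.
- exact: metric_unit.
- by move=> l; rewrite row_jac.
Qed.

End OneMap.

(** Were [w i * G j k - w j * G i k] nonzero, the symmetry could be solved for [A] as a multiple of
    [G]. So it vanishes, and [w i *: e_j - w j *: e_i] lies in the kernel of [G]. *)
Lemma tensor_vanish (R : realType) n (A G : 'M[R]_n) (w : 'I_n -> R) : (2 <= n)%N ->
  G \in unitmx -> (forall l, A <> l *: G) ->
  (forall i j k l m, w i * (G j k * A l m - A j k * G l m) =
                     w j * (G i k * A l m - A i k * G l m)) ->
  forall i, w i = 0.
Proof.
move=> n2 Gu nA h.
have sym i j k : w i * G j k = w j * G i k.
  apply: contrapT => /eqP ne; have c0 : w i * G j k - w j * G i k != 0 by rewrite subr_eq0.
  apply: (nA ((w i * A j k - w j * A i k) / (w i * G j k - w j * G i k))).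
  apply/matrixP => l m; rewrite mxE; apply: (mulfI c0).
  rewrite mulrA [in RHS]mulrCA divff // mulr1.
  by have := h i j k l m; lra.
move=> i; apply: contrapT => /eqP wi.
have [j ji] : exists j : 'I_n, j != i.
  have : (0 < #|predC1 i|)%N by rewrite cardC1 card_ord; lia.
  by case/card_gt0P => j; exists j.
have vG : (w i *: delta_mx 0 j - w j *: delta_mx 0 i : 'rV[R]_n) *m G = 0.
  rewrite mulmxBl -!scalemxAl -!rowE; apply/rowP => l; rewrite !mxE.
  by rewrite sym subrr.
have := congr1 (mulmx^~ (invmx G)) vG; rewrite mulmxK // mul0mx => /rowP/(_ j).
by rewrite !mxE !eqxx (negPf ji) /= mulr1 mulr0 subr0 => /eqP; rewrite (negPf wi).
Qed.

(** * Comparison of two maps inducing the same metric *)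

Section TwoMaps.
Variables (R : realType) (n k m : nat).
Notation N := (k.+1 + m.+1)%N.
Notation J := (lform R k m).
Notation J1 := (lform1 R k m).
Notation J2 := (lform2 R k m).
Variables (U : set 'rV[R]_n) (F H : 'rV[R]_n -> 'rV[R]_N).
Hypotheses (n_ge5 : (5 <= n)%N) (dimN : (n + 3)%N = N).
Hypotheses (openU : open U) (sF : smooth_on U F) (sH : smooth_on U H).
Hypotheses (F1 : forall x, U x -> bform J1 (F x) (F x) = -1)
  (F2 : forall x, U x -> bform J2 (F x) (F x) = 1).
Hypotheses (H1 : forall x, U x -> bform J1 (H x) (H x) = -1)
  (H2 : forall x, U x -> bform J2 (H x) (H x) = 1).
Hypothesis same_metric : forall x, U x -> metric F x = metric H x.
Hypothesis metric_pos : forall x, U x -> forall v, v != 0 -> 0 < bform (metric F x) v v.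
Hypothesis curvatures : forall x xi a, U x -> unit_normal_jet F x xi ->
  (3 <= \rank (second_form F x xi - a *: metric F x)%R)%N.

Let symJ : J^T = J. Proof. exact: lform_sym. Qed.

Lemma metric_def x : U x -> forall v, v != 0 -> bform (metric F x) v v != 0.
Proof. by move=> Ux v v0; apply: lt0r_neq0; exact: metric_pos. Qed.

Lemma metric_unitF x : U x -> metric F x \in unitmx.
Proof. by move=> Ux; apply: definite_unitmx; exact: metric_def. Qed.

Lemma metric_unitH x : U x -> metric H x \in unitmx.
Proof. by move=> Ux; rewrite -same_metric //; exact: metric_unitF. Qed.

Let jetF00 x : U x -> bform J (jet F [::] x) (jet F [::] x) = bform J (jet H [::] x) (jet H [::] x).
Proof. by move=> Ux; rewrite !jet_nil !(bform_addm J1 J2) F1 // F2 // H1 // H2. Qed.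

Let jetF11 i j x : U x ->
  bform J (jet F [:: i] x) (jet F [:: j] x) = bform J (jet H [:: i] x) (jet H [:: j] x).
Proof. by move=> Ux; rewrite -!metricE same_metric. Qed.

Let jetF10 := eq10 openU symJ sF sH jetF00.
Let jetF20 := eq20 openU symJ sF sH jetF00 jetF11.
Let jetF21 := eq21 openU symJ sF sH jetF11.
Let jetF22 := gauss openU symJ sF sH jetF11.

Section AtPoint.
Variables (x : 'rV[R]_n) (Ux : U x) (xi eta : 'rV[R]_N).
Hypotheses (xiF : unit_normal_jet F x xi) (etaH : unit_normal_jet H x eta).
Notation A := (second_form F x xi).
Notation B := (second_form H x eta).
Notation G := (metric F x).
Let D : 'M[R]_n := \matrix_(i, j)
  (bform J1 (jet F [:: i] x) (jet F [:: j] x) - bform J1 (jet H [:: i] x) (jet H [:: j] x)).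

(** The tangential terms are intrinsic and cancel. With c, c' the hyperbolic parts of metric
    coefficients g, g', the identity - c c' + (g - c) (g' - c') = g g' - c g' - g c' is linear in c
    and in c'; this is how the hyperbolic plane of the quadratic space arises. *)
Lemma jet2_product_diff i j p q :
  bform J (jet F [:: i; j] x) (jet F [:: p; q] x)
  - bform J (jet H [:: i; j] x) (jet H [:: p; q] x) =
  A i j * A p q - B i j * B p q - (D i j * G p q + G i j * D p q).
Proof.
have GH i' j' : metric F x i' j' = metric H x i' j' by rewrite same_metric.
rewrite (jet2_product openU sF F1 F2 dimN metric_unitF i j p q Ux xiF).
rewrite (jet2_product openU sH H1 H2 dimN metric_unitH i j p q Ux etaH).
rewrite (same_metric Ux).
have rE i' j' : (\row_l bform J (jet F [:: i'; j'] x) (jet F [:: l] x)) =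
   (\row_l bform J (jet H [:: i'; j'] x) (jet H [:: l] x)).
  by apply/rowP => l; rewrite !mxE jetF21.
rewrite !rE -!GH !metricE !(bform_addm J1 J2) ![D _ _]mxE.
have eq2 i' j' : bform J2 (jet H [:: i'] x) (jet H [:: j'] x) =
    bform J1 (jet F [:: i'] x) (jet F [:: j'] x) + bform J2 (jet F [:: i'] x) (jet F [:: j'] x)
    - bform J1 (jet H [:: i'] x) (jet H [:: j'] x).
  by have := jetF11 i' j' Ux; rewrite !(bform_addm J1 J2); lra.
rewrite !eq2; move: (bform (invmx _) _ _) (A i j) (A p q) (B i j) (B p q).
move=> t a1 a2 b1 b2.
move: (bform _ _ _) (bform _ _ _) (bform _ _ _) (bform _ _ _) (bform _ _ _) (bform _ _ _).
by move=> c1 c2 c3 c4 c5 c6; ring.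
Qed.

(** Exchanging [p] and [q] in [jet2_product_diff] and subtracting leaves on the left a combination
    that [gauss] makes zero. *)
Lemma second_form_flat (X Y Z W : 'rV[R]_n) :
  bform A X Z * bform A Y W - bform A X W * bform A Y Z
  - (bform B X Z * bform B Y W - bform B X W * bform B Y Z) =
  bform D X Z * bform G Y W + bform G X Z * bform D Y W
  - bform D X W * bform G Y Z - bform G X W * bform D Y Z.
Proof.
apply/eqP; rewrite -subr_eq0; apply/eqP; move: X; apply: linear_vanish => [a u v|i].
  by rewrite !(bformDl, bformZl); ring.
move: Y; apply: linear_vanish => [a u v|j]; first by rewrite !(bformDl, bformZl); ring.
move: Z; apply: linear_vanish => [a u v|p]; first by rewrite !(bformDr, bformZr); ring.
move: W; apply: linear_vanish => [a u v|q]; first by rewrite !(bformDr, bformZr); ring.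
rewrite !bform_delta.
have sw (P : 'rV[R]_n -> 'rV[R]_N) i' j' : smooth_on U P -> jet P [:: i'; j'] x = jet P [:: j'; i'] x.
  by move=> sP; rewrite (jet_swap openU i' j' [::] sP Ux).
have := jetF22 i q p j Ux; rewrite (sw F q j sF) (sw H q j sH) (sw F p j sF) (sw H p j sH).
have := jet2_product_diff i p j q; have := jet2_product_diff i q j p.
move: (A i p) (A i q) (A j p) (A j q) (B i p) (B i q) (B j p) (B j q).
move: (D i p) (D i q) (D j p) (D j q) (G i p) (G i q) (G j p) (G j q).
move: (bform _ _ _) (bform _ _ _) (bform _ _ _) (bform _ _ _).
by move=> *; lra.
Qed.

Lemma second_jets_eq i j p q : bform J (jet F [:: i; j] x) (jet F [:: p; q] x) =
  bform J (jet H [:: i; j] x) (jet H [:: p; q] x).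
Proof.
have symA := second_form_sym openU sF xi Ux.
have symB := second_form_sym openU sH eta Ux.
have symD : D^T = D.
  apply/matrixP => i' j'; rewrite !mxE.
  by congr (_ - _); rewrite (bformC _ _ (lform1_sym R k m)).
have := flat_null n_ge5 symA symB symD (metric_sym F x) (metric_def Ux) second_form_flat.
move=> /(_ (fun a => curvatures a Ux xiF)) null.
have := null (delta_mx 0 i) (delta_mx 0 j) (delta_mx 0 p) (delta_mx 0 q).
rewrite !bform_delta; have := jet2_product_diff i j p q.
move: (bform _ _ _) (bform _ _ _) (A i j * _) (B i j * _) (D i j * _) (G i j * _) => *; lra.
Qed.

Lemma second_form_nonscalar l : A <> l *: G.
Proof.
by move=> e; have := curvatures l Ux xiF; rewrite e subrr mxrank0.
Qed.
End AtPoint.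

(** A finite type indexing the derivatives of order at most two: [None] has order 0,
    [Some (i, None)] order 1 and [Some (i, Some j)] order 2. *)
Definition low_order (t : option ('I_n * option 'I_n)) : seq 'I_n :=
  if t is Some (i, s) then i :: (if s is Some j then [:: j] else [::]) else [::].

Lemma jets_form_eq x s t : U x ->
  bform J (jet F (low_order s) x) (jet F (low_order t) x) =
  bform J (jet H (low_order s) x) (jet H (low_order t) x).
Proof.
move=> Ux.
have [xi xiF] := unit_normal_jet_exists F1 dimN Ux.
have [eta etaH] := unit_normal_jet_exists H1 dimN Ux.
case: s => [[i [j|]]|]; case: t => [[p [q|]]|] /=.
- exact: (second_jets_eq Ux xiF etaH).
- exact: jetF21.
- exact: jetF20.
- by rewrite [LHS]bformC // [RHS]bformC //; exact: jetF21.
- exact: jetF11.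
- exact: jetF10.
- by rewrite [LHS]bformC // [RHS]bformC //; exact: jetF20.
- by rewrite [LHS]bformC // [RHS]bformC //; exact: jetF10.
- exact: jetF00.
Qed.

Definition jet_matrix (P : 'rV[R]_n -> 'rV[R]_N) x : 'M[R]_(#|{: option ('I_n * option 'I_n)}|, N) :=
  \matrix_t jet P (low_order (enum_val t)) x.

(** By [second_order_span] only 0 is orthogonal to the whole 2-jet; its last requirement holds
    because the second fundamental form is nowhere a multiple of the metric. *)
Lemma jet_matrix_full x : U x -> row_full (jet_matrix F x).
Proof.
move=> Ux; have [xi xiF] := unit_normal_jet_exists F1 dimN Ux.
rewrite /row_full -mxrank_tr -/(row_free _) -kermx_eq0.
apply: contraT => /rowV0Pn[v /sub_kermxP vM /negP[]]; apply/eqP.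
suff vJ : v *m J = 0 by rewrite -[v]mulmx1 -(lform_sqr R k m) mulmxA vJ mul0mx.
have wt t : bform J (v *m J) (jet F (low_order t) x) = 0.
  rewrite /bform -(mulmxA v) lform_sqr mulmx1.
  have -> : jet F (low_order t) x = row (enum_rank t) (jet_matrix F x).
    by rewrite rowK enum_rankK.
  by rewrite tr_row colE mulmxA vM mul0mx mxE.
have [a b c d] := xiF.
apply: (@second_order_span R n k m dimN (F x) (jac F x) (F1 Ux) (F2 Ux) _ _ (metric F x) _ _ xi
   a _ c d (fun i j => jet F [:: i; j] x)) => //.
- by move=> i; rewrite row_jac; exact: (jet1_J1 openU sF F1).
- by move=> i; rewrite row_jac; exact: (jet1_J2 openU sF F2).
- exact: metric_unitF.
- by move=> i; rewrite row_jac.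
- by move=> i j; exact: (jet2_J openU sF F1 F2).
- apply/eqP => G0; have := metric_unitF Ux; rewrite G0 -row_full_unit /row_full mxrank0.
  by move/eqP => n0; move: n_ge5; rewrite -n0.
- exact: (second_form_nonscalar Ux xiF).
- by have := wt None; rewrite /= jet_nil.
- by move=> i; rewrite row_jac; exact: (wt (Some (i, None))).
- by move=> i j; exact: (wt (Some (i, Some j))).
Qed.

Lemma jet_mulmx (V : set 'rV[R]_n) (Phi Psi : 'M[R]_N) : open V -> V `<=` U ->
  (forall y, V y -> F y *m Phi = F y *m Psi) ->
  forall s y, V y -> jet F s y *m Phi = jet F s y *m Psi.
Proof.
move=> oV VU e; elim=> [|i s IH] y Vy; first by rewrite jet_nil e.
have dcst (P : 'M[R]_N) : 'D_(basis_vec R i) (fun z => jet F s z *m P) y = jet F (i :: s) y *m P.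
  have [|_ ->] := @derivable_mulmx _ _ _ _ _ (jet F s) (cst P) y (basis_vec R i) _ (derivable_cst _ _ _).
    by apply: jet_derivable sF _; exact: VU.
  by rewrite derive_cst mulmx0 addr0 jet_cons.
rewrite -!dcst; apply: near_eq_derive.
by apply: (near_open oV Vy) => z Vz; exact: IH.
Qed.

(** The identity may be differentiated twice, and the 2-jet of [F] at [x] spans the space. *)
Lemma germ_unique (V : set 'rV[R]_n) (Phi Psi : 'M[R]_N) x : open V -> V `<=` U -> V x ->
  (forall y, V y -> F y *m Phi = F y *m Psi) -> Phi = Psi.
Proof.
move=> oV VU Vx e; apply: (row_full_inj (jet_matrix_full (VU _ Vx))).
by apply/row_matrixP => t; rewrite !row_mul rowK; exact: jet_mulmx oV VU e _ _ Vx.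
Qed.

Section AtFrame.
Variables (x0 : 'rV[R]_n) (Ux0 : U x0).
(** A choice of N derivatives independent at [x0], kept fixed nearby so that [Phi] is
    differentiable. *)
Let sel := fullrankfun (jet_matrix_full Ux0).
Let frame (P : 'rV[R]_n -> 'rV[R]_N) y : 'M[R]_N := rowsub sel (jet_matrix P y).
Let Phi y : 'M[R]_N := (\det (frame F y))^-1 *: (\adj (frame F y) *m frame H y).

Lemma row_frame P y i : row i (frame P y) = jet P (low_order (enum_val (sel i))) y.
Proof. by rewrite row_rowsub rowK. Qed.

Lemma frame_differentiable P y : smooth_on U P -> U y -> entrywise_differentiable (frame P) y.
Proof.
move=> sP Uy i j.
rewrite (_ : (fun z => _) = fun z => jet P (low_order (enum_val (sel i))) z 0 j).
  exact/differentiable_entries/(jet_differentiable _ sP).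
by apply/funext => z; rewrite !mxE.
Qed.

Lemma frame_unit_near : \near x0, frame F x0 \in unitmx.
Proof.
have u0 : \det (frame F x0) != 0.
  by have := fullrowsub_unit (jet_matrix_full Ux0); rewrite unitmxE unitfE.
have dc := differentiable_continuous (entrywise_det (frame_differentiable sF Ux0)).
apply: filterS (cvgr_neq0 _ dc u0) => y dy.
by rewrite unitmxE unitfE.
Qed.

Variable r : R.
Hypotheses (ballU : ball x0 r `<=` U) (ball_unit : forall y, ball x0 r y -> frame F y \in unitmx).

Lemma frame_Phi y : ball x0 r y -> frame F y *m Phi y = frame H y.
Proof.
move=> /ball_unit u; have -> : Phi y = invmx (frame F y) *m frame H y.
  by rewrite /Phi scalemxAl /invmx u.
exact: mulKVmx.
Qed.

Lemma gram_entry p (E : 'M[R]_(p, N)) i j : (E *m J *m E^T) i j = bform J (row i E) (row j E).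
Proof. by rewrite /bform tr_row colE mulmxA -colE [RHS]mxE -!row_mul [RHS]mxE. Qed.

Lemma frame_gram y : U y -> frame F y *m J *m (frame F y)^T = frame H y *m J *m (frame H y)^T.
Proof.
move=> Uy; apply/matrixP => i j; rewrite !gram_entry !row_frame.
exact: jets_form_eq.
Qed.

Lemma frame_unitH y : ball x0 r y -> frame H y \in unitmx.
Proof.
move=> By; have u := ball_unit By.
suff : frame H y *m J *m (frame H y)^T \in unitmx by rewrite !unitmx_mul => /andP[/andP[]].
by rewrite -frame_gram ?unitmx_mul ?unitmx_tr ?u ?lform_unit //; exact: ballU.
Qed.

Lemma Phi_isometry y : ball x0 r y -> Phi y *m J *m (Phi y)^T = J.
Proof.
move=> By; have u := ball_unit By; have ut : (frame F y)^T \in unitmx by rewrite unitmx_tr.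
apply: (can_inj (mulKmx u)); apply: (can_inj (mulmxK ut)).
by rewrite frame_gram; [rewrite -!(frame_Phi By) trmx_mul !mulmxA|exact: ballU].
Qed.

Lemma Phi_unit y : ball x0 r y -> Phi y \in unitmx.
Proof.
move=> By; have : frame F y *m Phi y \in unitmx by rewrite frame_Phi // frame_unitH.
by rewrite unitmx_mul => /andP[].
Qed.

(** [Phi] is defined by the selected derivatives only. For any other one, the difference of the two
    sides is orthogonal to the frame of [H], since [Phi] is an isometry and all scalar products
    agree. *)
Lemma jet_Phi y t : ball x0 r y -> jet F (low_order t) y *m Phi y = jet H (low_order t) y.
Proof.
move=> By; have Uy := ballU By; apply/eqP; rewrite -subr_eq0; apply/eqP.
have uHt : (frame H y)^T \in unitmx by rewrite unitmx_tr frame_unitH.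
apply: (can_inj (mulmxK (lform_unit R k m))); apply: (can_inj (mulmxK uHt)).
rewrite !mul0mx !mulmxBl -{1}(frame_Phi By) trmx_mul.
have -> : jet F (low_order t) y *m Phi y *m J *m ((Phi y)^T *m (frame F y)^T) =
   jet F (low_order t) y *m (Phi y *m J *m (Phi y)^T) *m (frame F y)^T by rewrite !mulmxA.
rewrite Phi_isometry //; apply/rowP => j; rewrite [RHS]mxE.
have e (P : 'rV[R]_n -> 'rV[R]_N) (u : 'rV[R]_N) : (u *m J *m (frame P y)^T) 0 j =
    bform J u (jet P (low_order (enum_val (sel j))) y).
  by rewrite -row_frame /bform tr_row colE mulmxA -colE [RHS]mxE.
by rewrite mxE [X in _ + X]mxE !e jets_form_eq // subrr.
Qed.

Lemma Phi_differentiable y : ball x0 r y -> entrywise_differentiable Phi y.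
Proof.
move=> By; have Uy := ballU By.
by apply: entrywise_solve; [exact: frame_differentiable|exact: frame_differentiable|exact: ball_unit].
Qed.

Let dPhi i y : 'M[R]_N := 'D_(basis_vec R i) Phi y.

Lemma Phi_derivable y v : ball x0 r y -> derivable Phi y v.
Proof. by move=> By; apply/entrywise_derivable/Phi_differentiable. Qed.

Hypothesis r_gt0 : 0 < r.

Lemma ball_near y (P : 'rV[R]_n -> Prop) : ball x0 r y -> (forall z, ball x0 r z -> P z) ->
  \near y, P y.
Proof. by move=> By; apply: near_open By; exact: ball_open. Qed.

Lemma derive_jet_Phi i t y : ball x0 r y ->
  jet F (i :: low_order t) y *m Phi y + jet F (low_order t) y *m dPhi i y =
  jet H (i :: low_order t) y.
Proof.
move=> By; have Uy := ballU By; rewrite !jet_cons.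
have [||_ <-] := @derivable_mulmx _ _ _ _ _ (jet F (low_order t)) Phi y (basis_vec R i).
- exact: jet_derivable sF Uy.
- exact: Phi_derivable.
by apply: near_eq_derive; apply: ball_near By _ => z Bz; exact: jet_Phi.
Qed.

Lemma derive_Phi_low i y : ball x0 r y -> F y *m dPhi i y = 0.
Proof.
move=> By; have := derive_jet_Phi i None By; rewrite /= jet_nil.
by rewrite (jet_Phi (Some (i, None)) By) => /(canRL (addKr _)); rewrite addNr.
Qed.

Lemma derive_Phi_low1 i j y : ball x0 r y -> jet F [:: j] y *m dPhi i y = 0.
Proof.
move=> By; have := derive_jet_Phi i (Some (j, None)) By.
by rewrite (jet_Phi (Some (i, Some j)) By) => /(canRL (addKr _)); rewrite addNr.
Qed.

(** Third derivatives of [F] and [H] are symmetric, so they cancel when [i] and [j] are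
    exchanged. *)
Lemma derive_Phi_low2 i j l y : ball x0 r y ->
  jet F [:: j; l] y *m dPhi i y = jet F [:: i; l] y *m dPhi j y.
Proof.
move=> By; have Uy := ballU By; have := derive_jet_Phi i (Some (j, Some l)) By.
rewrite /= (jet_swap openU i j [:: l] sF Uy) (jet_swap openU i j [:: l] sH Uy).
by rewrite -(derive_jet_Phi j (Some (i, Some l)) By) => /addrI.
Qed.

Lemma dPhi_skew i y : ball x0 r y -> (dPhi i y *m J *m (Phi y)^T)^T = - (dPhi i y *m J *m (Phi y)^T).
Proof.
move=> By; apply: bform_mxP => u v; rewrite bform_oppm.
have d (w : 'rV[R]_N) : derivable (fun z => w *m Phi z) y (basis_vec R i) /\
    'D_(basis_vec R i) (fun z => w *m Phi z) y = w *m dPhi i y.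
  have dP := Phi_derivable (v := basis_vec R i) By.
  have [dw ew] := derivable_mulmx (derivable_cst w y (basis_vec R i)) dP.
  by split=> //; rewrite ew derive_cst mul0mx add0r.
have [du eu] := d u; have [dv ev] := d v.
have [_ e] := derive_bform J du dv.
have : 'D_(basis_vec R i) (fun z => bform J (u *m Phi z) (v *m Phi z)) y = 0.
  rewrite -[RHS](derive_cst (bform J u v) y (basis_vec R i)); apply: near_eq_derive.
  apply: ball_near By _ => z Bz; rewrite /bform trmx_mul.
  by rewrite -[in RHS](Phi_isometry Bz) !mulmxA.
rewrite e eu ev => s.
have m1 (a b : 'rV[R]_N) : bform J (a *m dPhi i y) (b *m Phi y) =
    bform (dPhi i y *m J *m (Phi y)^T) a b by rewrite /bform trmx_mul !mulmxA.
have m2 (a b : 'rV[R]_N) (P : 'M[R]_N) : bform P^T a b = bform P b a.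
  by rewrite /bform -[in LHS](trmxK (a *m _ *m _)) [in LHS]mxE !trmx_mul !trmxK mulmxA.
by rewrite m2 -!m1; move: s; rewrite (bformC (u *m Phi y)) //; lra.
Qed.

(** Being skew and zero on the 1-jet, the i-th derivative is one number [w i] times a fixed skew
    form, whose value on second derivatives is a 2 x 2 minor in the metric and the second
    fundamental form. The symmetry in the first two indices is then the hypothesis of
    [tensor_vanish]. *)
Lemma dPhi_eq0 i y : ball x0 r y -> dPhi i y = 0.
Proof.
move=> By; have Uy := ballU By; have [xi xiF] := unit_normal_jet_exists F1 dimN Uy.
have [xa xb xc xd] := xiF.
pose P i := dPhi i y *m J *m (Phi y)^T.
pose w i := bform (P i) xi (part2 (F y)).
have normal i' u v : bform (P i') u v = (bform J u xi * bform J v (F y)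
    - bform J u (F y) * bform J v xi) * w i'.
  apply: (@skew_form_normal R n k m dimN (F y) (jac F y) (F1 Uy) (F2 Uy) _ _ (metric F y)) => //.
  - by move=> l; rewrite row_jac; exact: (jet1_J1 openU sF F1).
  - by move=> l; rewrite row_jac; exact: (jet1_J2 openU sF F2).
  - exact: metric_unitF.
  - by move=> l; rewrite row_jac.
  - exact: dPhi_skew.
  - by rewrite /P !mulmxA derive_Phi_low // !mul0mx.
  - by apply/row_matrixP => l; rewrite row_mul row_jac row0 /P !mulmxA derive_Phi_low1 // !mul0mx.
have key i1 j1 k1 l1 m1 : bform (P i1) (jet F [:: j1; k1] y) (jet F [:: l1; m1] y) =
    bform (P j1) (jet F [:: i1; k1] y) (jet F [:: l1; m1] y).
  by rewrite /bform /P !mulmxA derive_Phi_low2.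
have w0 : forall i', w i' = 0.
  clearbody w; clearbody P.
  apply: (tensor_vanish (A := second_form F y xi) (G := metric F y)).
  - exact: leq_trans n_ge5.
  - exact: metric_unitF.
  - exact: (second_form_nonscalar Uy xiF).
  move=> i1 j1 k1 l1 m1; have := key i1 j1 k1 l1 m1.
  have hF a b : bform J (jet F [:: a; b] y) (F y) = - metric F y a b.
    exact: (jet2_J openU sF F1 F2).
  have hA a b : bform J (jet F [:: a; b] y) xi = second_form F y xi a b by rewrite mxE.
  by rewrite !normal !hF !hA; lra.
have : P i = 0 by apply: bform_mxP => u v; rewrite normal w0 mulr0 /bform mulmx0 mul0mx mxE.
have ut : (Phi y)^T \in unitmx by rewrite unitmx_tr Phi_unit.
by move/(congr1 (mulmx^~ (invmx (Phi y)^T))); rewrite mulmxK // mul0mx =>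
  /(congr1 (mulmx^~ (invmx J))); rewrite mulmxK ?lform_unit // mul0mx.
Qed.

Lemma Phi_cst y : ball x0 r y -> Phi y = Phi x0.
Proof.
move=> By; apply/matrixP => i j.
apply: (derive0_ball_cst (f := fun z => Phi z i j) r_gt0) By => z.
  by move=> Bz; exact: Phi_differentiable.
move=> l Bz; have [_ ->] := is_derive_entry i j (Phi_derivable (v := basis_vec R l) Bz).
by rewrite -/(dPhi l z) dPhi_eq0 // mxE.
Qed.

End AtFrame.

Lemma local_rigidity x0 : U x0 -> exists (r : R) (Phi : 'M[R]_N),
  [/\ 0 < r, ball x0 r `<=` U, Phi *m J *m Phi^T = J &
   forall y, ball x0 r y -> F y *m Phi = H y].
Proof.
move=> Ux0; have nb := filterI (frame_unit_near Ux0) (open_nbhs_nbhs (conj openU Ux0)).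
have [r r0 Br] := (nbhs_ballP _ _).1 (nb _).
have BU : ball x0 r `<=` U by move=> y /Br[].
have Bu y (By : ball x0 r y) := (Br y By).1.
have B0 : ball x0 r x0 by exact: ballxx.
eexists r, _; split=> //; first exact: (Phi_isometry BU Bu B0).
move=> y By; rewrite -(Phi_cst BU Bu r0 By).
by have := jet_Phi BU Bu None By; rewrite /= !jet_nil.
Qed.

End TwoMaps.

(** * Hypersurfaces of the product *)

Section Charts.
Variables (R : realType) (n k m : nat) (M : smoothManifold R n) (G : riemannianMetric M).
Notation N := (k.+1 + m.+1)%N.
Notation J := (lform R k m).
Variables (f : M -> 'rV[R]_N) (f_isom : isometric_immersion G f).
Variable a : chart M.
Let U := coord a @` dom a.
Let F := f \o @param R n M a.

Lemma chart_image x : U x -> dom a (param a x) /\ coord a (param a x) = x.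
Proof. by move=> [p ap <-]; rewrite coordK. Qed.

Lemma local_form1 x : U x -> bform (lform1 R k m) (F x) (F x) = -1.
Proof. by have [h _ _] := f_isom; move=> _; rewrite lform1E; have [[->]] := h (param a x). Qed.

Lemma local_form2 x : U x -> bform (lform2 R k m) (F x) (F x) = 1.
Proof. by have [h _ _] := f_isom; move=> _; rewrite lform2E; have [_ ->] := h (param a x). Qed.

Lemma local_smooth : smooth_on U F.
Proof. by have [_ + _] := f_isom; exact. Qed.

Lemma jet1E x i : jet F [:: i] x = partial i F x.
Proof. by rewrite jet_cons jet_nil. Qed.

Lemma jet2E x i j : jet F [:: i; j] x = partial i (partial j F) x.
Proof. by rewrite !jet_cons jet_nil. Qed.

Lemma local_metric x : U x -> metric F x = gram G a (param a x).
Proof.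
move=> Ux; have [dx cx] := chart_image Ux; have [_ _ h] := f_isom.
apply/matrixP => i j; rewrite metricE !jet1E lformE /partial.
have dF : differentiable F x := local_smooth [::] Ux.
rewrite !(deriveE _ dF) -(bform_delta (gram G a (param a x))).
by have := h a (param a x) dx (basis_vec R i) (basis_vec R j); rewrite cx.
Qed.

Lemma local_metric_pos x : U x -> forall v, v != 0 -> 0 < bform (metric F x) v v.
Proof.
move=> Ux v v0; have [dx cx] := chart_image Ux.
by rewrite local_metric //; exact: gram_pos.
Qed.

Lemma unit_normal_local x xi : U x -> unit_normal_jet F x xi -> unit_normal f a (param a x) xi.
Proof.
move=> Ux [h1 h2 h3 h4]; have [dx cx] := chart_image Ux; split.
- by rewrite /tangent_HxS /= -lform1E -lform2E.
- by move=> i; rewrite /coord_tangent cx -lformE -jet1E.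
- by rewrite -lformE.
Qed.

(** Both projections subtract vectors orthogonal to [xi], so the flat second derivative has the same
    scalar product with [xi]. *)
Lemma second_fundamental_local x xi i j : U x -> unit_normal_jet F x xi ->
  ldot (second_fundamental_form G f a (param a x) i j) xi = second_form F x xi i j.
Proof.
move=> Ux [h1 h2 h3 h4]; have [dx cx] := chart_image Ux.
rewrite /second_fundamental_form /normal_component mxE.
set c := _ *m _; set P := proj_HxS _ _.
rewrite -lformE bformDl bformNl.
have -> : bform J (\sum_(l < n) c 0 l *: coord_tangent f a (param a x) l) xi = 0.
  elim/big_rec: _ => [|l v _ IH]; first exact: bform0l.
  by rewrite bformDl bformZl IH addr0 /coord_tangent cx -jet1E h2 mulr0.
rewrite oppr0 addr0 /P cx -jet2E lformE /ldot /proj_HxS row_mxKl row_mxKr.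
have lorentzD (u v w : 'rV[R]_k.+1) c' : lorentz (u + c' *: v) w = lorentz u w + c' * lorentz v w.
  rewrite /lorentz mulrDr !mulr_sumr.
  have -> : \sum_(l < k) (u + c' *: v) 0 (lift ord0 l) * w 0 (lift ord0 l) =
     \sum_(l < k) u 0 (lift ord0 l) * w 0 (lift ord0 l) +
     \sum_(l < k) c' * (v 0 (lift ord0 l) * w 0 (lift ord0 l)).
    by rewrite -big_split /=; apply: eq_bigr => l _; rewrite !mxE; ring.
  by rewrite !mxE; ring.
have euclidD (u v w : 'rV[R]_m.+1) c' : euclid (u - c' *: v) w = euclid u w - c' * euclid v w.
  rewrite /euclid mulr_sumr -sumrB.
  by apply: eq_bigr => l _; rewrite !mxE; ring.
rewrite lorentzD euclidD -[lorentz (lsubmx (f _)) (lsubmx xi)]lform1E.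
rewrite -[euclid (rsubmx (f _)) (rsubmx xi)]lform2E h3 h4 !mulr0 addr0 subr0.
by rewrite -[LHS]/(ldot _ _) -lformE.
Qed.

Lemma shape_operator_local x xi : U x -> unit_normal_jet F x xi ->
  shape_operator G f a (param a x) xi = second_form F x xi *m invmx (metric F x).
Proof.
move=> Ux nxi; rewrite /shape_operator local_metric //; congr (_ *m _).
by apply/matrixP => i j; rewrite [LHS]mxE second_fundamental_local.
Qed.

(** Rank at most two leaves a kernel of dimension at least n - 2. It is nonzero as n is at least 3,
    so [l] is a principal curvature, and its multiplicity exceeds n - 3. *)
Lemma curvature_rank x xi l : (3 <= n)%N -> U x -> unit_normal_jet F x xi ->
  (principal_curvature G f a (param a x) xi l ->
   ~ (n - 3 < multiplicity G f a (param a x) xi l)%N) ->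
  (3 <= \rank (second_form F x xi - l *: metric F x)%R)%N.
Proof.
move=> n3 Ux nxi; rewrite /principal_curvature /multiplicity /eigenvalue /eigenspace.
rewrite shape_operator_local //; set S := _ *m _ => h.
have mu : metric F x \in unitmx.
  apply: definite_unitmx => v v0; apply: lt0r_neq0; exact: local_metric_pos.
have -> : second_form F x xi - l *: metric F x = (S - l%:M) *m metric F x.
  by rewrite mulmxBl mulmxKV // mul_scalar_mx.
rewrite mxrankMfree ?row_free_unit //.
rewrite ltnNge; apply/negP => r2.
have rk := mxrank_ker (S - l%:M).
apply: h; last by rewrite rk; lia.
by rewrite -mxrank_eq0 rk; lia.
Qed.
End Charts.

(** * From local to global congruence *)

Section Global.
Variables (R : realType) (n k m : nat) (M : smoothManifold R n) (G : riemannianMetric M).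
Notation N := (k.+1 + m.+1)%N.
Notation J := (lform R k m).
Variables (f g : M -> 'rV[R]_N).
Hypotheses (f_isom : isometric_immersion G f) (g_isom : isometric_immersion G g).
Hypotheses (n_ge5 : (5 <= n)%N) (dimN : (n + 3)%N = N).
Hypothesis f_mult : forall (p : M) (a : chart M) (xi : 'rV[R]_N) (lambda : R),
  dom a p -> unit_normal f a p xi -> principal_curvature G f a p xi lambda ->
  ~ (n - 3 < multiplicity G f a p xi lambda)%N.

Lemma chart_curvatures (a : chart M) x xi l : (coord a @` dom a) x ->
  unit_normal_jet (f \o param a) x xi ->
  (3 <= \rank (second_form (f \o param a) x xi - l *: metric (f \o param a) x)%R)%N.
Proof.
move=> Ux nxi; have [dx cx] := chart_image Ux.
apply: (curvature_rank (G := G) f_isom) => //; first by lia.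
by apply: f_mult => //; exact: unit_normal_local.
Qed.

Lemma chart_same_metric (a : chart M) x : (coord a @` dom a) x ->
  metric (f \o param a) x = metric (g \o param a) x.
Proof. by move=> Ux; rewrite (local_metric f_isom) // (local_metric g_isom). Qed.

Lemma locally_congruent (p : M) : exists2 Phi : 'M[R]_N, Phi *m J *m Phi^T = J &
  \forall q \near p, f q *m Phi = g q.
Proof.
have [a ap] := dom_cover p.
have Ux : (coord a @` dom a) (coord a p) by exists p.
have [r [Phi [r0 BU iPhi h]]] := local_rigidity n_ge5 dimN (@coord_dom_open _ _ M a)
  (local_smooth f_isom (a := a)) (local_smooth g_isom (a := a))
  (local_form1 f_isom (a := a)) (local_form2 f_isom (a := a))
  (local_form1 g_isom (a := a)) (local_form2 g_isom (a := a))
  (@chart_same_metric a) (local_metric_pos f_isom (a := a)) (@chart_curvatures a) Ux.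
exists Phi => //.
have na : nbhs p (dom a) by apply: open_nbhs_nbhs; split=> //; exact: dom_open.
have nb : nbhs p (coord a @^-1` ball (coord a p) r).
  by apply: (coord_continuous ap); exact: nbhsx_ballx.
by apply: filterS2 na nb => q aq bq; have := h _ bq; rewrite /= coordK.
Qed.

Lemma congruence_unique (p : M) (Phi Psi : 'M[R]_N) :
  (\forall q \near p, f q *m Phi = g q) -> (\forall q \near p, f q *m Psi = g q) -> Phi = Psi.
Proof.
move=> hPhi hPsi; have [a ap] := dom_cover p.
have Ux : (coord a @` dom a) (coord a p) by exists p.
have nP : nbhs (coord a p) (param a @^-1` [set q | f q *m Phi = f q *m Psi]).
  apply: (param_continuous ap); rewrite coordK //.
  by apply: (filterS2 _ _ hPhi hPsi) => q /= -> ->.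
apply: (germ_unique n_ge5 dimN (@coord_dom_open _ _ M a) (local_smooth f_isom (a := a))
  (local_form1 f_isom (a := a)) (local_form2 f_isom (a := a))
  (local_metric_pos f_isom (a := a)) (@chart_curvatures a)
  (V := interior [set x | f (param a x) *m Phi = f (param a x) *m Psi] `&` (coord a @` dom a))
  (x := coord a p)).
- by apply: openI; [exact: open_interior|exact: (@coord_dom_open _ _ M a)].
- by move=> y [].
- by split.
- by move=> y [/interior_subset].
Qed.

Lemma globally_congruent : connected [set: M] -> exists2 Phi : 'M[R]_N,
  Phi *m J *m Phi^T = J & forall p, f p *m Phi = g p.
Proof.
(* The empty set is connected in this sense; the identity serves for an empty manifold. *)
move=> conn; have [[p0 _]|noM] := pselect (exists p : M, True); last first.
  exists 1%:M; first by rewrite mul1mx trmx1 mulmx1.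
  by move=> p; case: noM; exists p.
have [Phi iPhi near0] := locally_congruent p0; exists Phi => //.
pose S := interior [set q | f q *m Phi = g q].
suff ST : S = [set: M] by move=> p; have /interior_subset : S p by rewrite ST.
apply: conn.
- by exists p0.
- by exists S; [exact: open_interior|rewrite setTI].
(* At a limit point [q] the local isometry [Psi] and [Phi] both carry [f] to [g] near some point of
   [S], hence coincide. *)
- exists S; last by rewrite setTI.
  move=> q clq; have [Psi _ nearq] := locally_congruent q.
  have [p [Sp pq]] := clq _ (nbhs_interior nearq).
  by rewrite /S (congruence_unique Sp pq).
Qed.
End Global.

Theorem corollary21 (R : realType) (n k : nat)
    (n_ge5 : (5 <= n)%N) (k_ge2 : (2 <= k)%N) (k_le : (k <= n - 1)%N)
    (M : smoothManifold R n) (M_connected : connected [set: M])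
    (G : riemannianMetric M)
    (f : M -> 'rV[R]_(k.+1 + (n - k + 1).+1))
    (f_isom : isometric_immersion G f)
    (f_mult : forall (p : M) (a : chart M) (xi : 'rV[R]_(k.+1 + (n - k + 1).+1))
                (lambda : R),
       dom a p -> unit_normal f a p xi ->
       principal_curvature G f a p xi lambda ->
       ~ (n - 3 < multiplicity G f a p xi lambda)%N) :
  weakly_rigid G f.
Proof.
move=> g g_isom.
(* The truncated difference [n - k] is exact because [k] is at most [n - 1]. *)
have dimN : (n + 3)%N = (k.+1 + (n - k + 1).+1)%N by lia.
have [Phi iPhi fg] := globally_congruent f_isom g_isom n_ge5 dimN f_mult M_connected.
exists (mulmxr Phi); last by apply/funext => p; rewrite /= fg.
by move=> z w; rewrite -!lformE /bform /= trmx_mul -[in RHS]iPhi !mulmxA.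
Qed.
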